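(* Let $n\ge 2$, let $r\in(0,1)$ be such that $r\overline{\mathbb{D}}^n\subseteq\mathbb{G}_n$, let $k(i)=\binom{n-1}{i}+\binom{n-1}{n-i}$ for $1\le i\le n$, and let $M=\max\{k(i):1\le i\le n\}$. Let $\delta_1,\dots,\delta_n\in\mathbb{C}$ satisfy $0<|\delta_i|<r/M$ for $1\le i\le n$, and put $\lambda_i=s_i(\delta_1,\dots,\delta_n)$ for $1\le i\le n$. Assume that $\lambda_i\ne 0$ for $1\le i\le n$ and that $\lambda_i\overline{\lambda}_{n-j}\ne\lambda_j\overline{\lambda}_{n-i}$ for all $1\le i\ne j\le n-1$. Define $$T_i=\begin{bmatrix}0&\lambda_i\\0&0\end{bmatrix},\qquad 1\le i\le n.$$ Then $(T_1,\dots,T_n)$ is a $\Gamma_n$-contraction, and its fundamental operators $F_1,\dots,F_{n-1}$ satisfy none of the conditions $$F_iF_j=F_jF_i\quad\text{and}\quad F_iF_{n-j}^*-F_jF_{n-i}^*=F_{n-j}^*F_i-F_{n-i}^*F_j,\qquad 1\le i\ne j\le n-1;$$ that is, for every pair $i\neq j$ in $\{1,\dots,n-1\}$ both equalities fail.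
   Context: Let $\mathbf{s}=(s_1,\dots,s_n):\mathbb{C}^n\to\mathbb{C}^n$ be the symmetrization map, $s_i(z_1,\dots,z_n)=\sum_{1\le k_1<\dots<k_i\le n} z_{k_1}\cdots z_{k_i}$ for $1\le i\le n$. Let $\mathbb{D}$ be the open unit disc, $\mathbb{G}_n=\mathbf{s}(\mathbb{D}^n)$ and $\Gamma_n=\mathbf{s}(\overline{\mathbb{D}}^n)$ (the closure of $\mathbb{G}_n$). Here $r\overline{\mathbb{D}}^n=\{(rz_1,\dots,rz_n): |z_i|\le 1 \text{ for all } i\}$; an $r\in(0,1)$ with $r\overline{\mathbb{D}}^n\subseteq\mathbb{G}_n$ exists. Binomial coefficients $\binom{a}{b}$ with $b>a\geq 0$ are $0$. For a compact set $\Omega\subset\mathbb{C}^n$, $\mathcal{O}(\Omega)$ is the algebra of functions that are bounded and holomorphic in some neighbourhood of $\Omega$, with $\|f\|_{\infty,\Omega}=\sup_{z\in\Omega}|f(z)|$. $\Omega$ is a spectral set for a commuting $n$-tuple $\mathbf{T}=(T_1,\dots,T_n)$ of bounded Hilbert space operators if the joint spectrum satisfies $\sigma(\mathbf{T})\subset\Omega$ and $\|f(\mathbf{T})\|\le\|f\|_{\infty,\Omega}$ for all $f\in\mathcal{O}(\Omega)$ (holomorphic functional calculus). For commuting matrices the joint spectrum is the set of joint eigenvalues. A commuting $n$-tuple of bounded operators is a $\Gamma_n$-contraction if $\Gamma_n$ is a spectral set for it. Complex $2\times2$ matrices are regarded as operators on $\mathbb{C}^2$. For a contraction $T$, $D_T=(I-T^*T)^{1/2}$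 and $\mathcal{D}_T=\overline{\operatorname{Ran}}\,D_T$. The fundamental operators of a $\Gamma_n$-contraction $(T_1,\dots,T_n)$ are the (known to exist and be unique) operators $F_1,\dots,F_{n-1}\in\mathcal{B}(\mathcal{D}_{T_n})$ satisfying $T_i-T_{n-i}^*T_n=D_{T_n}F_iD_{T_n}$ for $1\le i\le n-1$. *)

(* Defs.v *)
From HB Require Import structures.
From mathcomp Require Import all_boot all_order all_algebra.
From mathcomp Require Import all_classical all_reals all_analysis.
From mathcomp Require Import complex.
Set Implicit Arguments.
Unset Strict Implicit.
Unset Printing Implicit Defensive.
Import Order.TTheory GRing.Theory Num.Theory.
Import numFieldNormedType.Exports.
Local Open Scope classical_set_scope.
Local Open Scope ring_scope.
Local Open Scope sesquilinear_scope.

(* R[i] bundled as a numClosedFieldType, so that it and its matrices carry the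
   topology and norm that MathComp-Analysis puts on any numFieldType. *)
Definition cplx (R : realType) : numClosedFieldType := R[i].

(* Modulus with values in R; the norm `|z| of the library lies in R[i]. *)
Definition cmod (R : realType) (z : cplx R) : R := complex.Re (`|z| : R[i]).

Section Symmetrization.
Variables (R : realType) (n : nat).
Local Notation C := (cplx R).
Implicit Type z : 'rV[C]_n.

Definition elem_sym (i : nat) z : C :=
  \sum_(A : {set 'I_n} | #|A| == i) \prod_(k in A) z 0 k.

(* Entry i (counted from 0) is s_(i+1). *)
Definition symmetrization z : 'rV[C]_n := \row_(i < n) elem_sym i.+1 z.

Definition open_polydisc : set 'rV[C]_n := [set z | forall i, `|z 0 i| < 1].
Definition closed_polydisc : set 'rV[C]_n := [set z | forall i, `|z 0 i| <= 1].

Definition open_sym_polydisc : set 'rV[C]_n := symmetrization @` open_polydisc.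
Definition Gamma : set 'rV[C]_n := symmetrization @` closed_polydisc.

End Symmetrization.
Arguments Gamma : clear implicits.
Arguments open_sym_polydisc : clear implicits.
Arguments closed_polydisc : clear implicits.
Arguments open_polydisc : clear implicits.

Section Holomorphic.
Variables (R : realType) (n : nat).
Local Notation C := (cplx R).
Implicit Types (K U : set 'rV[C]_n) (f : 'rV[C]_n -> C).

(* Differentiability is taken over the scalar field C, i.e. it is complex
   Frechet differentiability. *)
Definition holomorphic_on U f := forall z, U z -> differentiable f z.

Definition holomorphic_near K f :=
  exists U, [/\ open U, K `<=` U & holomorphic_on U f].

(* Membership in O(K). *)
Definition bounded_holomorphic_near K f :=
  exists U, [/\ open U, K `<=` U, holomorphic_on U f
              & exists B : R, forall z, U z -> cmod (f z) <= B].

Definition sup_norm K f : R := sup [set cmod (f z) | z in K].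

End Holomorphic.

Section Operators.
Variables (R : realType) (m : nat).
Local Notation C := (cplx R).
Implicit Types (A D F : 'M[C]_m) (v : 'cV[C]_m).

(* m x m matrices act on the Hilbert space C^m of column vectors. *)
Definition l2norm v : R := Num.sqrt (\sum_i cmod (v i 0) ^+ 2).

Definition op_norm A : R := sup [set l2norm (A *m v) | v in [set v | l2norm v <= 1]].

Definition positive_mx D :=
  D = D ^t* /\ forall v, 0 <= (v ^t* *m D *m v) 0 0.

(* D = (I - A^* A)^(1/2), the positive square root being unique. *)
Definition is_defect A D := positive_mx D /\ D *m D = 1%:M - A ^t* *m A.

(* For D selfadjoint, the operators on Ran D, each identified with its
   extension by 0 to (Ran D)^perp = Ker D: the first condition says that F maps
   into Ran D, the second that F vanishes on Ker D (%MS compares row spaces). *)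
Definition operator_on_range D F := (F^T <= D^T)%MS /\ (F <= D)%MS.

End Operators.

Section SpectralSet.
Variables (R : realType) (n m : nat).
Local Notation C := (cplx R).
Implicit Types (T : 'I_n -> 'M[C]_m) (Om : set 'rV[C]_n).

Definition joint_spectrum T : set 'rV[C]_n :=
  [set l | exists2 v : 'cV[C]_m, v != 0 & forall i, T i *m v = l 0 i *: v].

(* Phi is the holomorphic functional calculus f |-> f(T): the continuous unital
   algebra morphism on the algebra of germs of functions holomorphic near
   sigma(T) that sends the i-th coordinate function to T_i. For a commuting
   tuple of matrices it exists and is unique: Phi maps the indicator germs of
   the points of sigma(T) to the projections on the joint generalized
   eigenspaces, and Taylor expansion at these points determines the rest. The
   values of Phi on functions not holomorphic near sigma(T) are irrelevant. *)
Record holomorphic_calculus T (Phi : ('rV[C]_n -> C) -> 'M[C]_m) : Prop := {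
  calc_one : Phi (fun=> 1) = 1%:M ;
  calc_coord : forall i, Phi (fun z => z 0 i) = T i ;
  calc_add : forall f g, holomorphic_near (joint_spectrum T) f ->
    holomorphic_near (joint_spectrum T) g ->
    Phi (fun z => f z + g z) = Phi f + Phi g ;
  calc_scale : forall (c : C) f, holomorphic_near (joint_spectrum T) f ->
    Phi (fun z => c * f z) = c *: Phi f ;
  calc_mul : forall f g, holomorphic_near (joint_spectrum T) f ->
    holomorphic_near (joint_spectrum T) g ->
    Phi (fun z => f z * g z) = Phi f *m Phi g ;
  calc_germ : forall f g U, open U -> joint_spectrum T `<=` U ->
    holomorphic_on U f -> (forall z, U z -> f z = g z) -> Phi f = Phi g ;
  calc_cont : forall (f_ : nat -> 'rV[C]_n -> C) f U,
    open U -> joint_spectrum T `<=` U ->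
    (forall k, holomorphic_on U (f_ k)) -> holomorphic_on U f ->
    {uniform U, f_ @ \oo --> f} ->
    Phi (f_ k) @[k --> \oo] --> Phi f
}.

(* Meant for compact Om. As the calculus Phi is unique, the existential
   quantifier asserts the bound for f(T) = Phi f. *)
Definition spectral_set Om T :=
  [/\ forall i j, T i *m T j = T j *m T i,
      joint_spectrum T `<=` Om
    & exists2 Phi, holomorphic_calculus T Phi
        & forall f, bounded_holomorphic_near Om f ->
            op_norm (Phi f) <= sup_norm Om f].

End SpectralSet.

Section GammaContractions.
Variables (R : realType) (n m : nat).
Local Notation C := (cplx R).
Implicit Types T F : nat -> 'M[C]_m.

(* Tuples are numbered from 1: T stands for (T_1, ..., T_n) and F for
   (F_1, ..., F_(n-1)); values at other indices are not used. *)
Definition Gamma_contraction T := spectral_set (Gamma R n) (fun i : 'I_n => T i.+1).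

Definition fundamental_operators T F :=
  exists2 D, is_defect (T n) D &
    forall i, (1 <= i < n)%N ->
      operator_on_range D (F i) /\
      T i - (T (n - i)%N) ^t* *m T n = D *m F i *m D.

End GammaContractions.
Arguments Gamma_contraction {R} n {m} T.
Arguments fundamental_operators {R} n {m} T F.

(* Main.v *)
Require Import Defs.
From HB Require Import structures.
From mathcomp Require Import all_boot all_order all_algebra.
From mathcomp Require Import all_classical all_reals all_analysis.
From mathcomp Require Import complex ring lra.
Import Order.TTheory GRing.Theory Num.Theory.
Import numFieldNormedType.Exports.
Local Open Scope classical_set_scope.
Local Open Scope ring_scope.
Local Open Scope sesquilinear_scope.

(** The tuple is [T_i = lam_i N] with [N] the nilpotent matrix unit, so its
joint spectrum is the origin and the functional calculus is
[f |-> f(0) I + (D_lam f)(0) N], where [lam = s(delta)] and [D_lam] is the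
derivative along [lam].

Spectral set. By Pascal's rule [k(i)] is the binomial coefficient [C(n, i)],
hence [|lam_i| <= C(n, i) (r/M)^i <= r]: the point [z lam] lies in the
polydisc of radius [r], and so in [Gamma_n], whenever [|z| <= 1]. A function
[f] holomorphic near [Gamma_n] restricts to [g(z) = f(z lam)] on the closed
unit disc, and [f(T) = g(0) I + g'(0) N]. The bound for [f(T)] is therefore
von Neumann's inequality for the single contraction [N]: this triangular
Toeplitz matrix has norm at most [sup |g|] ([toeplitz_bound]). It also
contains Cauchy's estimate [|g'(0)| <= sup |g|], which gives the continuity of
the calculus under uniform convergence.

The Toeplitz bound rests on three Fourier coefficients of [g] on the unit
circle: [g(0)], [g'(0)], and [0] in degree [-1]. They are obtained as limits
of averages over the [2^K]-th roots of unity, without any integral. The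
trapezoid sums of a function along the boundary of a square, pulled back by a
Lipschitz parametrization, are exactly additive under subdivision of the
square; Goursat's bisection argument applied to them ([discrete_goursat])
shows that they tend to zero for a complex differentiable function. In polar
coordinates this says that the averages of [g(z) z^-m] over the unit circle
and over a small circle have the same limit ([circle_avg_diff]), and on a
small circle the first-order expansion of [g] at [0] gives the value. Bessel's
inequality for the finite averages ([bessel]) then yields the norm bound.

Fundamental operators. Here [I - T_n^* T_n] is diagonal with distinct
eigenvalues [1] and [1 - |lam_n|^2], so its positive square root is
[diag(1, d)] with [d > 0], which is invertible and determines [F_i]: with
[lam_i / d] in position [(0, 1)] and
[- conj(lam_(n-i)) lam_n / d^2] in position [(1, 1)]. The commutator of [F_i]
and [F_j], and the upper left entry in the second condition, are both nonzero
multiples of [lam_i conj(lam_(n-j)) - lam_j conj(lam_(n-i))]. *)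

Set Implicit Arguments.
Unset Strict Implicit.

(** * The real-valued modulus *)

Section Modulus.
Variable R : realType.
Local Notation C := (cplx R).
Implicit Types x y z w : C.

Lemma normE z : `|z| = (cmod z)%:C%C.
Proof. by rewrite /cmod normc_def. Qed.

Lemma cmodE z : cmod z = Num.sqrt (complex.Re z ^+ 2 + complex.Im z ^+ 2).
Proof. by rewrite /cmod normc_def. Qed.

Lemma cmod_ge0 z : 0 <= cmod z.
Proof. by rewrite cmodE sqrtr_ge0. Qed.

Lemma cmodM z w : cmod (z * w) = cmod z * cmod w.
Proof. by apply: complexI; rewrite -normE normrM !normE rmorphM. Qed.

Lemma cmodN z : cmod (- z) = cmod z.
Proof. by rewrite /cmod normrN. Qed.

Lemma cmodB z w : cmod (z - w) = cmod (w - z).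
Proof. by rewrite /cmod distrC. Qed.

Lemma cmodV z : cmod z^-1 = (cmod z)^-1.
Proof. by apply: complexI; rewrite -normE normfV normE fmorphV. Qed.

Lemma cmod0 : cmod (0 : C) = 0.
Proof. by rewrite /cmod normr0. Qed.

Lemma cmod1 : cmod (1 : C) = 1.
Proof. by rewrite /cmod normr1. Qed.

Lemma cmod_eq0 z : (cmod z == 0) = (z == 0).
Proof. by rewrite -(inj_eq (@complexI R)) -normE normr_eq0. Qed.

Lemma cmod_gt0 z : (0 < cmod z) = (z != 0).
Proof. by rewrite lt_neqAle cmod_ge0 andbT eq_sym cmod_eq0. Qed.

Lemma cmodD z w : cmod (z + w) <= cmod z + cmod w.
Proof. by rewrite -lecR rmorphD /= -!normE ler_normD. Qed.

Lemma cmod_real (a : R) : cmod (a%:C%C : C) = `|a|.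
Proof. by rewrite cmodE /= expr0n addr0 sqrtr_sqr. Qed.

Lemma cmodX z n : cmod (z ^+ n) = cmod z ^+ n.
Proof. by elim: n => [|n IH]; rewrite ?cmod1 // !exprS cmodM IH. Qed.

Lemma cmod_nat n : cmod (n%:R : C) = n%:R.
Proof. by rewrite -(rmorph_nat (real_complex R)) cmod_real normr_nat. Qed.

Lemma cmod_sum (I : Type) (s : seq I) (P : pred I) (F : I -> C) :
  cmod (\sum_(i <- s | P i) F i) <= \sum_(i <- s | P i) cmod (F i).
Proof.
elim/big_ind2: _ => //; first by rewrite cmod0.
by move=> x a y b xa yb; apply: le_trans (cmodD _ _) _; rewrite lerD.
Qed.

Lemma cmod_prod (I : Type) (s : seq I) (P : pred I) (F : I -> C) :
  cmod (\prod_(i <- s | P i) F i) = \prod_(i <- s | P i) cmod (F i).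
Proof. by elim/big_ind2: _ => [|x a y b <- <-|//]; rewrite ?cmod1 ?cmodM. Qed.

Lemma cmod_sqr z : ((cmod z) ^+ 2)%:C%C = z * z^* :> C.
Proof. by rewrite rmorphXn /= -normE normCK. Qed.

End Modulus.

(** * Goursat's theorem for trapezoid sums *)

Section Goursat.
Variable R : realType.
Local Notation C := (cplx R).

(** Stated with the real modulus, so that the estimates can be carried out in the
ordered field of reals. *)
Definition has_cderiv (F : C -> C) (z b : C) := forall e : R, 0 < e ->
  exists2 d : R, 0 < d & forall w, cmod (w - z) < d ->
    cmod (F w - F z - b * (w - z)) <= e * cmod (w - z).

(** Twice the trapezoid rule for the integral of [F] along the segment from [p]
to [q]; the factor is immaterial for sums that tend to zero. *)
Definition trapezoid (F : C -> C) (p q : C) : C := (F p + F q) * (q - p).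

Definition trapezoid_sum (F : C -> C) (K : nat) (c : R -> C) (a h : R) : C :=
  \sum_(i < 2 ^ K) trapezoid F (c (a + h * (i%:R / 2 ^+ K)))
                          (c (a + h * (i.+1%:R / 2 ^+ K))).

(** The nodes of level [K.+1] on an interval are the nodes of level [K] on its two
halves. This exact additivity is what allows sums to replace integrals in
Goursat's argument. *)
Lemma trapezoid_sum_split F K c a h :
  trapezoid_sum F K.+1 c a h =
  trapezoid_sum F K c a (h / 2) + trapezoid_sum F K c (a + h / 2) (h / 2).
Proof.
rewrite /trapezoid_sum expnS mul2n -addnn big_split_ord /=.
have P0 : (2 ^+ K : R) != 0 by rewrite expf_neq0 // pnatr_eq0.
by congr (_ + _); apply: eq_bigr => i _; congr (trapezoid F (c _) (c _));
  rewrite -?addnS ?natrD ?natrX exprS; field; rewrite P0.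
Qed.

(** The trapezoid rule is exact on affine functions: [G] is twice a primitive
of [F]. *)
Lemma trapezoid_affine (F : C -> C) al b
    (G := fun z => al * z *+ 2 + b * z ^+ 2) p q :
  (forall z, F z = al + b * z) -> trapezoid F p q = G q - G p.
Proof. by move=> FE; rewrite /trapezoid !FE /G; ring. Qed.

Lemma trapezoid_sum_affine (F : C -> C) al b
    (G := fun z => al * z *+ 2 + b * z ^+ 2) K c a h :
  (forall z, F z = al + b * z) ->
  trapezoid_sum F K c a h = G (c (a + h)) - G (c a).
Proof.
move=> FE; rewrite /trapezoid_sum.
under eq_bigr do rewrite (@trapezoid_affine F al b) //.
rewrite -(big_mkord xpredT (fun i => G (c (a + h * (i.+1%:R / 2 ^+ K))) -
  G (c (a + h * (i%:R / 2 ^+ K))))) telescope_sumr // natrX divff ?mulr1 ?mul0r ?mulr0 ?addr0 //.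
Qed.

Lemma trapezoid_sumD F1 F2 K c a h :
  trapezoid_sum (fun z => F1 z + F2 z) K c a h =
  trapezoid_sum F1 K c a h + trapezoid_sum F2 K c a h.
Proof.
rewrite /trapezoid_sum -big_split; apply: eq_bigr => i _.
by rewrite /trapezoid /=; ring.
Qed.

Lemma trapezoid_sum_bound F K c (a h D L : R) : 0 <= h ->  0 <= D ->
  (forall x, a <= x <= a + h -> cmod (F (c x)) <= D) ->
  (forall x y, a <= x <= a + h -> a <= y <= a + h ->
    cmod (c x - c y) <= L * `|x - y|) ->
  cmod (trapezoid_sum F K c a h) <= 2 * D * L * h.
Proof.
move=> h0 D0 FD cL; rewrite /trapezoid_sum.
have P0 : (0 < 2 ^+ K :> R) by rewrite exprn_gt0.
have inI (i : nat) : (i <= 2 ^ K)%N -> a <= a + h * (i%:R / 2 ^+ K) <= a + h.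
  move=> iK; rewrite lerDl lerD2l mulr_ge0 ?divr_ge0 //=.
  by rewrite ler_piMr // ler_pdivrMr // mul1r -natrX ler_nat.
apply: le_trans (cmod_sum _ _ _) _.
have -> : 2 * D * L * h = \sum_(i < 2 ^ K) (2 * D * (L * (h / 2 ^+ K))).
  by rewrite sumr_const card_ord -[RHS]mulr_natr natrX; field; rewrite gt_eqF.
apply: ler_sum => i _; rewrite /trapezoid cmodM.
have i1 := inI _ (ltnW (ltn_ord i)); have i2 := inI _ (ltn_ord i).
apply: ler_pM; rewrite ?cmod_ge0 //.
  by apply: le_trans (cmodD _ _) _; rewrite [2 * D]mulr_natl [D *+ 2]mulr2n lerD // FD.
apply: le_trans (cL _ _ i2 i1) _; rewrite le_eqVlt; apply/orP; left.
apply/eqP; congr (_ * _); rewrite -natr1.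
have -> : a + h * ((i%:R + 1) / 2 ^+ K) - (a + h * (i%:R / 2 ^+ K)) = h / 2 ^+ K.
  by field; rewrite gt_eqF.
by rewrite ger0_norm // divr_ge0 // ltW.
Qed.

Definition boundary_sum (F : C -> C) (K : nat) (psi : R -> R -> C) (s t h : R) : C :=
  trapezoid_sum F K (psi^~ t) s h + trapezoid_sum F K (psi (s + h)) t h
  - trapezoid_sum F K (psi^~ (t + h)) s h - trapezoid_sum F K (psi s) t h.

(** The four inner edges are each traversed twice, in opposite directions. *)
Lemma boundary_sum_split F K psi s t h :
  boundary_sum F K.+1 psi s t h =
  boundary_sum F K psi s t (h / 2) +
  boundary_sum F K psi (s + h / 2) t (h / 2) +
  boundary_sum F K psi s (t + h / 2) (h / 2) +
  boundary_sum F K psi (s + h / 2) (t + h / 2) (h / 2).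
Proof.
rewrite /boundary_sum !trapezoid_sum_split -!addrA -splitr; ring.
Qed.

Definition square_lipschitz (psi : R -> R -> C) (L : R) :=
  forall s t s' t', 0 <= s <= 1 -> 0 <= t <= 1 -> 0 <= s' <= 1 -> 0 <= t' <= 1 ->
   cmod (psi s t - psi s' t') <= L * (`|s - s'| + `|t - t'|).

(** The affine part of [F] at a point of the square contributes nothing, since
its trapezoid sums telescope around the closed boundary. On the remainder the
modulus is at most [e] times the diameter [2 L h] of the image and each of the
four sides has length at most [L h]; the bound is thus [e] times the area
[h ^+ 2], up to a constant that depends neither on the square nor on [K]. *)
Lemma boundary_sum_local F K psi (L s t h s0 t0 : R) b (e d : R) : 0 <= L -> 0 <= e ->
  square_lipschitz psi L -> 0 <= h -> 0 <= s -> s + h <= 1 -> 0 <= t -> t + h <= 1 ->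
  s <= s0 <= s + h -> t <= t0 <= t + h -> L * (h + h) < d ->
  (forall w, cmod (w - psi s0 t0) < d ->
    cmod (F w - F (psi s0 t0) - b * (w - psi s0 t0)) <= e * cmod (w - psi s0 t0)) ->
  cmod (boundary_sum F K psi s t h) <= 16 * e * L ^+ 2 * h ^+ 2.
Proof.
move=> L0 e0 psiL h0 s_ge0 sh t_ge0 th ss tt Ld Fd.
set z0 := psi s0 t0 in Fd *.
pose A z := F z0 - b * z0 + b * z.
pose E z := F z - A z.
have FE c a : trapezoid_sum F K c a h = trapezoid_sum A K c a h + trapezoid_sum E K c a h.
  by rewrite -trapezoid_sumD; congr trapezoid_sum; apply/funext => z; rewrite /E; ring.
have AE : boundary_sum A K psi s t h = 0.
  rewrite /boundary_sum !(@trapezoid_sum_affine A (F z0 - b * z0) b) //; ring.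
have -> : boundary_sum F K psi s t h = boundary_sum E K psi s t h.
  by rewrite -[RHS]add0r -AE /boundary_sum !FE; ring.
have Eb x y : s <= x <= s + h -> t <= y <= t + h -> cmod (E (psi x y)) <= e * (L * (h + h)).
  move=> xs yt.
  have pb : cmod (psi x y - z0) <= L * (h + h).
    apply: le_trans (psiL _ _ _ _ _ _ _ _) _; try lra.
    by rewrite ler_wpM2l // lerD // ler_norml; lra.
  have -> : E (psi x y) = F (psi x y) - F z0 - b * (psi x y - z0) by rewrite /E /A; ring.
  by apply: le_trans (Fd _ (le_lt_trans pb Ld)) _; rewrite ler_wpM2l.
have D0 : 0 <= e * (L * (h + h)) by rewrite !mulr_ge0 // addr_ge0.
pose side := 2 * (e * (L * (h + h))) * L * h.
have L1 y : t <= y <= t + h -> cmod (trapezoid_sum E K (psi^~ y) s h) <= side.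
  move=> yt; apply: trapezoid_sum_bound => // [x xs|x x' xs xs']; first exact: Eb.
  have -> : L * `|x - x'| = L * (`|x - x'| + `|y - y|) by rewrite subrr normr0 addr0.
  by apply: psiL; lra.
have L2 x : s <= x <= s + h -> cmod (trapezoid_sum E K (psi x) t h) <= side.
  move=> xs; apply: trapezoid_sum_bound => // [y yt|y y' yt yt']; first exact: Eb.
  have -> : L * `|y - y'| = L * (`|x - x| + `|y - y'|) by rewrite subrr normr0 add0r.
  by apply: psiL; lra.
have -> : 16 * e * L ^+ 2 * h ^+ 2 = side + side + side + side.
  by rewrite /side; ring.
have L1' y : t <= y <= t + h -> cmod (- trapezoid_sum E K (psi^~ y) s h) <= side.
  by rewrite cmodN; exact: L1.
have L2' x : s <= x <= s + h -> cmod (- trapezoid_sum E K (psi x) t h) <= side.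
  by rewrite cmodN; exact: L2.
rewrite /boundary_sum; apply: le_trans (cmodD _ _) _; apply: lerD; last by apply: L2'; lra.
apply: le_trans (cmodD _ _) _; apply: lerD; last by apply: L1'; lra.
by apply: le_trans (cmodD _ _) _; apply: lerD; [apply: L1|apply: L2]; lra.
Qed.

Lemma half_pow_lt (h d : R) : 0 < h -> 0 < d -> exists k : nat, h / 2 ^+ k < d.
Proof.
move=> h0 d0; exists (Num.trunc (h / d)).+1.
have hk := truncnS_gt (h / d).
rewrite ltr_pdivrMr ?exprn_gt0 // mulrC -ltr_pdivrMr //.
apply: lt_trans hk _; rewrite -natrX ltr_nat; exact: ltn_expl.
Qed.

Lemma nested_limit (s h : nat -> R) : (forall k, 0 <= h k) ->
  (forall k, s k <= s k.+1) -> (forall k, s k.+1 + h k.+1 <= s k + h k) ->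
  exists x, forall k, s k <= x <= s k + h k.
Proof.
move=> h0 sS shS.
have sm : {homo s : i j / (i <= j)%N >-> i <= j} by apply: homo_leq => //; exact: le_trans.
have shm i j : (i <= j)%N -> s j + h j <= s i + h i.
  elim: j => [|j IH]; first by rewrite leqn0 => /eqP->.
  rewrite leq_eqVlt => /predU1P[->//|/IH]; exact: le_trans.
have b i j : s i <= s j + h j.
  case: (leP i j) => ij.
    apply: le_trans (sm _ _ ij) _; by rewrite lerDl.
  apply: le_trans (shm _ _ (ltnW ij)); by rewrite lerDl.
exists (sup (range s)) => k; apply/andP; split.
  by apply: ub_le_sup; [exists (s 0%N + h 0%N) => _ [i _ <-]|exists k].
by apply: ge_sup; [exists (s 0%N), 0%N|move=> _ [i _ <-]].
Qed.

(** Choosing bad quarters one after the other gives nested squares, which shrink to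
a common point. The boolean pair selects the quarter. *)
Lemma bisection (bad : R -> R -> R -> Prop) (s0 t0 h0 : R) : 0 < h0 -> bad s0 t0 h0 ->
  (forall s t h : R, 0 < h -> bad s t h -> exists p : bool * bool,
     bad (s + h / 2 *+ p.1) (t + h / 2 *+ p.2) (h / 2)) ->
  exists s t, forall d, 0 < d -> exists s' t' h',
    [/\ 0 < h' < d, s' <= s <= s' + h', t' <= t <= t' + h' & bad s' t' h'].
Proof.
move=> h0_gt0 bad0 step.
have /choice[f fP] (x : R * R * R) : exists p : bool * bool,
    0 < x.2 -> bad x.1.1 x.1.2 x.2 ->
     bad (x.1.1 + x.2 / 2 *+ p.1) (x.1.2 + x.2 / 2 *+ p.2) (x.2 / 2).
  have [[x0 bx]|nb] := pselect (0 < x.2 /\ bad x.1.1 x.1.2 x.2).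
    by have [p pP] := step _ _ _ x0 bx; exists p.
  by exists (false, false) => x0 bx; case: nb.
pose nx (x : R * R * R) :=
  (x.1.1 + x.2 / 2 *+ (f x).1, x.1.2 + x.2 / 2 *+ (f x).2, x.2 / 2).
pose u k := iter k nx (s0, t0, h0).
have uS k : u k.+1 = nx (u k) by [].
have uh k : (u k).2 = h0 / 2 ^+ k.
  elim: k => [|k IH]; first by rewrite expr0 divr1.
  by rewrite uS /= IH exprSr invfM mulrA.
have uh0 k : 0 < (u k).2 by rewrite uh divr_gt0 // exprn_gt0.
have ub k : bad (u k).1.1 (u k).1.2 (u k).2.
  by elim: k => // k IH; rewrite uS /=; exact: fP.
have step_le (a h : R) (p : bool) : 0 < h ->
    a <= a + h / 2 *+ p /\ a + h / 2 *+ p + h / 2 <= a + h.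
  by case: p => h'; rewrite ?mulr1n ?mulr0n; split; lra.
have [s sP] : exists x, forall k, (u k).1.1 <= x <= (u k).1.1 + (u k).2.
  apply: nested_limit => k; rewrite ?uS /=; first exact: ltW.
    by case: (step_le (u k).1.1 (u k).2 (f (u k)).1 (uh0 k)).
  by case: (step_le (u k).1.1 (u k).2 (f (u k)).1 (uh0 k)).
have [t tP] : exists x, forall k, (u k).1.2 <= x <= (u k).1.2 + (u k).2.
  apply: nested_limit => k; rewrite ?uS /=; first exact: ltW.
    by case: (step_le (u k).1.2 (u k).2 (f (u k)).2 (uh0 k)).
  by case: (step_le (u k).1.2 (u k).2 (f (u k)).2 (uh0 k)).
exists s, t => d d0; have [k kd] := half_pow_lt h0_gt0 d0.
by exists (u k).1.1, (u k).1.2, (u k).2; split; rewrite // uh0 uh.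
Qed.

(** If the boundary sums exceed [e] times the area for arbitrarily fine levels,
then the same is true of a quarter of the square, hence of arbitrarily small
squares around some point, which contradicts the differentiability there. *)
Lemma discrete_goursat F psi L : 0 < L -> square_lipschitz psi L ->
  (forall s t, 0 <= s <= 1 -> 0 <= t <= 1 -> exists b, has_cderiv F (psi s t) b) ->
  forall e, 0 < e -> exists K0, forall K, (K0 <= K)%N ->
    cmod (boundary_sum F K psi 0 0 1) <= e.
Proof.
move=> L0 psiL Fd e e0; apply: contrapT => nope.
pose good (s t h : R) := exists K0, forall K, (K0 <= K)%N ->
  cmod (boundary_sum F K psi s t h) <= e * h ^+ 2.
pose bad (s t h : R) := [/\ 0 <= s, s + h <= 1, 0 <= t, t + h <= 1 & ~ good s t h].
have [||s [t stP]] := @bisection bad 0 0 1 ltr01.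
- split; rewrite ?add0r // => -[K0 K0P]; apply: nope; exists K0 => K.
  by move=> /K0P; rewrite expr1n mulr1.
- move=> s t h h0 [s_ge0 sh t_ge0 th ng]; apply: contrapT => nb; apply: ng.
  have gd (p : bool * bool) : good (s + h / 2 *+ p.1) (t + h / 2 *+ p.2) (h / 2).
    apply: contrapT => ng; apply: nb; exists p.
    by case: p ng => -[] [] /=; rewrite ?mulr0n ?mulr1n; split => //; lra.
  have [K1 K1P] := gd (false, false); have [K2 K2P] := gd (true, false).
  have [K3 K3P] := gd (false, true); have [K4 K4P] := gd (true, true).
  exists (maxn (maxn K1 K2) (maxn K3 K4)).+1 => -[//|K].
  rewrite ltnS !geq_max => /andP[/andP[/K1P k1 /K2P k2] /andP[/K3P k3 /K4P k4]].
  move: k1 k2 k3 k4; rewrite /= !mulr1n !mulr0n !addr0 => k1 k2 k3 k4.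
  rewrite boundary_sum_split.
  have -> : e * h ^+ 2 = e * (h / 2) ^+ 2 + e * (h / 2) ^+ 2 + e * (h / 2) ^+ 2 +
    e * (h / 2) ^+ 2 by field.
  by do 3![apply: le_trans (cmodD _ _) _; rewrite lerD //].
have [s01 t01] : 0 <= s <= 1 /\ 0 <= t <= 1.
  by have [s' [t' [h' [? ? ? [? ? ? ? _]]]]] := stP 1 ltr01; split; lra.
have [b bP] := Fd s t s01 t01.
(* The precision that the constant of [boundary_sum_local] turns into [e]. *)
have e'0 : 0 < e / (16 * L ^+ 2) by rewrite divr_gt0 // mulr_gt0 // exprn_gt0.
have [d d0 dP] := bP _ e'0.
have d'0 : 0 < d / (2 * L) by rewrite divr_gt0 // mulr_gt0.
have [s' [t' [h' [/andP[h0 h1] ss tt [? ? ? ? ng]]]]] := stP _ d'0.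
apply: ng; exists 0%N => K _.
have -> : e * h' ^+ 2 = 16 * (e / (16 * L ^+ 2)) * L ^+ 2 * h' ^+ 2.
  by field; rewrite gt_eqF.
apply: (@boundary_sum_local _ _ _ _ _ _ _ s t b _ d) => //; try exact: ltW.
by move: h1; rewrite ltr_pdivlMr ?mulr_gt0 //; lra.
Qed.

End Goursat.

(** * Complex derivatives *)

Section ComplexDerivative.
Variable R : realType.
Local Notation C := (cplx R).

Lemma gt0_cplx (d : C) : 0 < d -> exists2 r : R, 0 < r & d = r%:C%C.
Proof.
move=> d0; exists (complex.Re d); first by move: d0; rewrite ltcE => /andP[].
by rewrite RRe_real // gtr0_real.
Qed.

Lemma derivable_has_cderiv (F : C -> C) z : derivable F z 1 -> has_cderiv F z ('D_1 F z).
Proof.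
move=> dF e e0.
have eC : 0 < (e%:C%C : C) by rewrite ltcR.
have lF : h^-1 *: ((F \o shift z) (h *: 1) - F z) @[h --> 0^'] --> 'D_1 F z by exact: dF.
have lF_e := cvgr_dist_le _ _ lF _ eC.
have FF : Filter (0 : C)^' by exact: dnbhs_filter.
have [d /= d0 dP] := (nbhs_ballP _ _).1 (lF_e FF).
have [r r0 dr] := gt0_cplx d0; exists r => // w wr.
have [->|wz] := eqVneq w z; first by rewrite !subrr mulr0 subr0 cmod0 mulr0.
have wz0 : w - z != 0 by rewrite subr_eq0.
have := dP (w - z); rewrite /ball /= sub0r normrN normE dr ltcR => /(_ wr wz0).
rewrite normE lecR => H.
have -> : F w - F z - 'D_1 F z * (w - z) =
  - ('D_1 F z - (w - z)^-1 *: (F ((w - z) *: 1 + z) - F z)) * (w - z).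
  rewrite /GRing.scale /= mulr1 subrK; field; exact: wz0.
by rewrite cmodM cmodN ler_wpM2r ?cmod_ge0.
Qed.

Lemma has_cderiv_div (F : C -> C) m z : derivable F z 1 -> z != 0 ->
  exists b, has_cderiv (fun y => F y / y ^+ m) z b.
Proof.
move=> dF z0; exists ('D_1 (fun y : C => F y / y ^+ m) z); apply: derivable_has_cderiv.
have -> : (fun y : C => F y / y ^+ m) = F * (fun y : C => (y ^+ m)^-1) by apply/funext.
have dX : derivable (fun y : C => y ^+ m) z 1 by exact: exprn_derivable.
have zm0 : z ^+ m != 0 by rewrite expf_neq0.
have dV : derivable (fun y : C => (y ^+ m)^-1) z 1.
  by have := @derivableV C _ (fun y : C => y ^+ m) z 1 zm0 dX.
by have := @derivableM C _ F (fun y : C => (y ^+ m)^-1) z 1 dF dV.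
Qed.

End ComplexDerivative.

(** * Averages over roots of unity *)

Section Cis.
Variable R : realType.
Local Notation C := (cplx R).

(** The full turn is normalized to length one, so that dyadic parameters give the
roots of unity of order a power of two. *)
Definition cis (t : R) : C := (cos (pi *+ 2 * t) +i* sin (pi *+ 2 * t))%C.

Lemma cisD s t : cis (s + t) = cis s * cis t.
Proof.
by rewrite /cis mulrDr cosD sinD; apply/eqP; rewrite eq_complex /= eqxx addrC /=.
Qed.

Lemma cis0 : cis 0 = 1.
Proof. by rewrite /cis mulr0 cos0 sin0. Qed.

Lemma cis1 : cis 1 = 1.
Proof. by rewrite /cis mulr1 cos2pi sin2pi. Qed.

Lemma cis_half : cis (1 / 2) = -1.
Proof.
rewrite /cis; have -> : pi *+ 2 * (1 / 2) = pi :> R by rewrite -mulr_natr; field.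
by rewrite cospi sinpi; apply/eqP; rewrite eq_complex /= oppr0 !eqxx.
Qed.

Lemma cmod_cis t : cmod (cis t) = 1.
Proof. by rewrite cmodE /= cos2Dsin2 sqrtr1. Qed.

Lemma cisMn t n : cis (t *+ n) = cis t ^+ n.
Proof. by elim: n => [|n IH]; rewrite ?cis0 // mulrS exprS cisD IH. Qed.

Lemma cmod_le_ReIm (z : C) : cmod z <= `|complex.Re z| + `|complex.Im z|.
Proof.
rewrite cmodE; set a := complex.Re z; set b := complex.Im z.
have e : Num.sqrt ((`|a| + `|b|) ^+ 2) = `|a| + `|b| by rewrite sqrtr_sqr ger0_norm ?addr_ge0.
rewrite -e; apply: ler_wsqrtr; rewrite sqrrD !real_normK ?num_real //.
by rewrite addrAC lerDl mulrn_wge0 // mulr_ge0.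
Qed.

(** The mean value theorem. *)
Lemma lipschitz1 (f df : R -> R) : (forall x : R, is_derive x (1 : R) f (df x)) ->
  (forall x, `|df x| <= 1) -> forall x y : R, `|f x - f y| <= `|x - y|.
Proof.
move=> fd d1; suff H x y : x <= y -> `|f x - f y| <= `|x - y|.
  move=> x y; case: (leP x y) => [/H//|/ltW/H]; by rewrite distrC [`|y - x|]distrC.
move=> xy; have [|c _ e] := MVT_segment xy (fun x _ => fd x).
  apply: derivable_within_continuous => z _; exact: ex_derive.
by rewrite distrC e normrM [`|x - y|]distrC ler_piMl.
Qed.

Lemma cis_lipschitz s t : cmod (cis s - cis t) <= 4 * pi * `|s - t|.
Proof.
apply: le_trans (cmod_le_ReIm _) _.
have pi0 : 0 <= pi *+ 2 :> R by rewrite mulrn_wge0 //; exact: pi_ge0.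
have c := lipschitz1 (fun x => is_derive_cos x).
have {}c := c (fun x => ltac:(rewrite normrN; exact: sin_max)).
have s' := lipschitz1 (fun x => is_derive_sin x) (@cos_max R).
have -> : 4 * pi * `|s - t| = `|pi *+ 2 * s - pi *+ 2 * t| + `|pi *+ 2 * s - pi *+ 2 * t|.
  by rewrite -mulrBr normrM (ger0_norm pi0); ring.
by apply: lerD; [exact: c|exact: s'].
Qed.

Definition dyadic_root K : C := cis (1 / 2 ^+ K).
Local Notation w := dyadic_root.

Lemma root_cis K n : w K ^+ n = cis (n%:R / 2 ^+ K).
Proof. by rewrite -cisMn -mulrnAl. Qed.

Lemma root_full K : w K ^+ (2 ^ K) = 1.
Proof. by rewrite root_cis natrX divff ?cis1 // expf_neq0 // pnatr_eq0. Qed.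

Lemma cmod_root K : cmod (w K) = 1. Proof. exact: cmod_cis. Qed.

Lemma root_neq0 K : w K != 0.
Proof. by rewrite -cmod_eq0 cmod_root oner_eq0. Qed.

Lemma root_half K : w K.+1 ^+ (2 ^ K) = -1.
Proof.
rewrite root_cis natrX exprSr invfM mulrA divff ?cis_half //.
Qed.

Lemma rootS K : w K.+1 ^+ 2 = w K.
Proof. by rewrite root_cis /w exprS; congr cis; field; rewrite expf_neq0 // pnatr_eq0. Qed.

(** The powers of the root of level [K.+1] walk from [1] to [-1] in [2 ^ K] equal
steps, so each step has length at least [2 / 2 ^ K]; this lower bound avoids
any estimate of the sine near zero. *)
Lemma root_gap K : 8 <= 2 ^+ K.+2 * cmod (w K.+2 - (w K.+2)^-1).
Proof.
have -> : cmod (w K.+2 - (w K.+2)^-1) = cmod (w K.+1 - 1).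
  rewrite -[RHS]divr1 -(cmod_root K.+2) -cmodV -cmodM -(rootS K.+1); congr cmod.
  by field; exact: root_neq0.
have : cmod (w K.+1 ^+ (2 ^ K) - 1) <= 2 ^+ K * cmod (w K.+1 - 1).
  rewrite subrX1 cmodM mulrC ler_wpM2r ?cmod_ge0 //.
  apply: le_trans (cmod_sum _ _ _) _.
  under eq_bigr do rewrite cmodX cmod_root expr1n.
  by rewrite sumr_const card_ord natrX.
rewrite root_half -opprD cmodN (_ : 1 + 1 = 2%:R) // cmod_nat !exprS; lra.
Qed.

Lemma sum_root0 K : \sum_(i < 2 ^ K.+1) w K.+1 ^+ i = 0.
Proof.
have /eqP := subrX1 (w K.+1) (2 ^ K.+1).
rewrite root_full subrr eq_sym mulf_eq0 => /orP[|/eqP//].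
rewrite subr_eq0 => /eqP w1; have := root_half K; rewrite w1 expr1n => /eqP.
by rewrite -subr_eq0 opprK (_ : 1 + 1 = 2%:R) // pnatr_eq0.
Qed.

Lemma sum_rootV0 K : \sum_(i < 2 ^ K.+1) (w K.+1 ^+ i)^-1 = 0.
Proof.
have /eqP := subrX1 (w K.+1)^-1 (2 ^ K.+1).
rewrite exprVn root_full invr1 subrr eq_sym mulf_eq0 => /orP[|/eqP e].
  rewrite subr_eq0 => /eqP w1; have := root_half K.
  rewrite -[w K.+1]invrK w1 invr1 expr1n => /eqP.
  by rewrite -subr_eq0 opprK (_ : 1 + 1 = 2%:R) // pnatr_eq0.
by rewrite -[RHS]e; apply: eq_bigr => i _; rewrite exprVn.
Qed.

Definition circle_avg K (H : C -> C) (rho : R) : C :=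
  (2 ^+ K)^-1 * \sum_(i < 2 ^ K) H (rho%:C%C * w K ^+ i).

Lemma sum_cyclic n (H : nat -> C) : H n = H 0%N ->
  \sum_(i < n) H i.+1 = \sum_(i < n) H i.
Proof.
case: n => [|n] H0; first by rewrite !big_ord0.
by rewrite big_ord_recr big_ord_recl /= H0 addrC.
Qed.

(** Summation by parts over a cyclic sequence: each node [z] receives the
difference of its two neighbours, which is [(w - w^-1) * z]. *)
Lemma trapezoid_sum_circle F K (rho : R) :
  trapezoid_sum F K (fun t => rho%:C%C * cis t) 0 1 =
  (w K - (w K)^-1) * \sum_(i < 2 ^ K) F (rho%:C%C * w K ^+ i) * (rho%:C%C * w K ^+ i).
Proof.
pose z i := (rho%:C%C : C) * w K ^+ i.
have zS i : z i.+1 = w K * z i by rewrite /z exprS mulrCA.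
have zP i : (rho%:C%C : C) * cis (0 + 1 * (i%:R / 2 ^+ K)) = z i.
  by rewrite add0r mul1r /z root_cis.
rewrite /trapezoid_sum; under eq_bigr do rewrite !zP.
have -> : \sum_(i < 2 ^ K) trapezoid F (z i) (z i.+1) =
  \sum_(i < 2 ^ K) F (z i) * (w K * z i - z i) +
  \sum_(i < 2 ^ K) F (z i.+1) * (z i.+1 - (w K)^-1 * z i.+1).
  rewrite -big_split; apply: eq_bigr => i _ /=; rewrite /trapezoid zS; field.
  exact: root_neq0.
rewrite (sum_cyclic (H := fun i => F (z i) * (z i - (w K)^-1 * z i))); last first.
  by rewrite /z root_full expr0.
rewrite -big_split mulr_sumr; apply: eq_bigr => i _ /=; rewrite -/(z i); ring.
Qed.

(** The polar map of the unit square onto the annulus takes the sides [t = 0] and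
[t = 1] to the same segment, so only the sums over the two circles remain
in the boundary sum, which tends to zero by [discrete_goursat]. *)
Lemma circle_avg_diff F (a : R) : 0 < a < 1 ->
  (forall z, a <= cmod z <= 1 -> exists b, has_cderiv F z b) ->
  forall e, 0 < e -> exists K0, forall K, (K0 <= K)%N ->
  cmod (circle_avg K (fun z => F z * z) 1 - circle_avg K (fun z => F z * z) a) <= e.
Proof.
move=> a01 Fd e e0.
pose rho s := a + s * (1 - a).
pose psi (s t : R) : C := (rho s)%:C%C * cis t.
have rho01 s : 0 <= s <= 1 -> a <= rho s <= 1 by rewrite /rho; nra.
have pi0 : 0 <= pi *+ 2 :> R by rewrite mulrn_wge0 //; exact: pi_ge0.
have psiL : square_lipschitz psi (1 + 4 * pi).
  move=> s t s' t' s01 t01 s'01 t'01.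
  have -> : psi s t - psi s' t' = (rho s - rho s')%:C%C * cis t + (rho s')%:C%C * (cis t - cis t').
    by rewrite rmorphB /psi; ring.
  apply: le_trans (cmodD _ _) _; rewrite !cmodM !cmod_real cmod_cis mulr1.
  have h1 : `|rho s - rho s'| <= `|s - s'|.
    have -> : rho s - rho s' = (s - s') * (1 - a) by rewrite /rho; ring.
    by rewrite normrM ler_piMr // ger0_norm; lra.
  have h2 : `|rho s'| * cmod (cis t - cis t') <= 4 * pi * `|t - t'|.
    rewrite -[leRHS]mul1r ler_pM ?cmod_ge0 ?cis_lipschitz // ger0_norm; have := rho01 _ s'01; lra.
  have := normr_ge0 (s - s'); have := normr_ge0 (t - t'); nra.
have L0 : 0 < 1 + 4 * pi :> R by lra.
have [s t s01 t01||K0 K0P] := discrete_goursat (F := F) L0 psiL _ (e := e * 8).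
- apply: Fd; rewrite /psi cmodM cmod_cis mulr1 cmod_real ger0_norm; have := rho01 _ s01; lra.
- by rewrite mulr_gt0.
exists (maxn K0 2) => K; rewrite geq_max => /andP[/K0P H].
case: K H => [//|[//|K]] H _.
move: H; rewrite /boundary_sum !add0r.
have -> : psi^~ 1 = psi^~ 0 by apply/funext => s; rewrite /psi cis0 cis1.
(* The two radial sides cancel. *)
rewrite [X in X - trapezoid_sum _ _ (psi^~ 0) _ _]addrC addrK.
have -> : psi 1 = fun t => (1 : R)%:C%C * cis t.
  by apply/funext => t; rewrite /psi /rho mul1r addrC subrK.
have -> : psi 0 = fun t => (a : R)%:C%C * cis t.
  by apply/funext => t; rewrite /psi /rho mul0r addr0.
rewrite !trapezoid_sum_circle -mulrBr cmodM /circle_avg -mulrBr cmodM cmodV cmodX cmod_nat.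
set D := cmod (_ - _); set E := cmod (_ - _) => H.
have P0 : (0 < 2 ^+ K.+2 :> R) by rewrite exprn_gt0.
rewrite mulrC ler_pdivrMr //.
have := root_gap K; rewrite -/D => gap.
have E0 : 0 <= E by exact: cmod_ge0.
nra.
Qed.

Lemma circle_avg_const K (c : C) rho : circle_avg K (fun=> c) rho = c.
Proof.
rewrite /circle_avg sumr_const card_ord -[c *+ _]mulr_natr natrX mulrCA mulVf ?mulr1 //.
Qed.

Lemma circle_avg_bound K H rho S : (forall z, cmod z = `|rho| -> cmod (H z) <= S) ->
  cmod (circle_avg K H rho) <= S.
Proof.
move=> HS; rewrite /circle_avg cmodM cmodV cmodX cmod_nat mulrC ler_pdivrMr ?exprn_gt0 //.
apply: le_trans (cmod_sum _ _ _) _.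
rewrite -natrX mulr_natr -[X in _ *+ X]card_ord -sumr_const ler_sum // => i _.
by apply: HS; rewrite cmodM cmodX cmod_root expr1n mulr1 cmod_real.
Qed.

Lemma circle_avgD K H1 H2 rho :
  circle_avg K (fun z => H1 z + H2 z) rho =
  circle_avg K H1 rho + circle_avg K H2 rho.
Proof. by rewrite /circle_avg big_split mulrDr. Qed.

Lemma circle_avgZ K c H rho :
  circle_avg K (fun z => c * H z) rho = c * circle_avg K H rho.
Proof. by rewrite /circle_avg -mulr_sumr mulrCA. Qed.

Lemma circle_avgB K H1 H2 rho :
  circle_avg K (fun z => H1 z - H2 z) rho =
  circle_avg K H1 rho - circle_avg K H2 rho.
Proof.
rewrite (circle_avgD K H1 (fun z => - H2 z)) -mulN1r -circle_avgZ.
by congr (_ + circle_avg _ _ _); apply/funext => z; rewrite mulN1r.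
Qed.

Lemma circle_avg_ext K H1 H2 rho : (forall z, cmod z = `|rho| -> H1 z = H2 z) ->
  circle_avg K H1 rho = circle_avg K H2 rho.
Proof.
move=> H12; rewrite /circle_avg; congr (_ * _); apply: eq_bigr => i _; apply: H12.
by rewrite cmodM cmodX cmod_root expr1n mulr1 cmod_real.
Qed.

Lemma circle_avg_inv K rho : circle_avg K.+1 (fun z => z^-1) rho = 0.
Proof.
rewrite /circle_avg; under eq_bigr do rewrite invfM.
by rewrite -mulr_sumr sum_rootV0 !mulr0.
Qed.

Lemma circle_avg_id K rho : circle_avg K.+1 (fun z => z) rho = 0.
Proof. by rewrite /circle_avg -mulr_sumr sum_root0 !mulr0. Qed.

End Cis.

(** * Bessel's inequality on the circle *)

Section Bessel.
Variable R : realType.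
Local Notation C := (cplx R).

Lemma circle_avg_conj K (H : C -> C) rho :
  circle_avg K (fun z => (H z)^*) rho = (circle_avg K H rho)^*.
Proof. by rewrite /circle_avg rmorphM fmorphV rmorphXn rmorph_nat rmorph_sum. Qed.

Lemma circle_avg_le K (H1 H2 : C -> C) rho : (forall z, cmod z = `|rho| -> H1 z <= H2 z) ->
  circle_avg K H1 rho <= circle_avg K H2 rho.
Proof.
move=> H12; rewrite /circle_avg ler_wpM2l ?invr_ge0 ?exprn_ge0 ?ler0n //.
apply: ler_sum => i _; apply: H12.
by rewrite cmodM cmodX cmod_root expr1n mulr1 cmod_real.
Qed.

Lemma conj_unit (z : C) : cmod z = 1 -> z^* = z^-1.
Proof.
move=> z1; have z0 : z != 0 by rewrite -cmod_eq0 z1 oner_eq0.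
have := cmod_sqr z; rewrite z1 expr1n => e.
by apply: (mulfI z0); rewrite -e mulfV.
Qed.

Lemma cmod_unit_neq0 (z : C) : cmod z = 1 -> z != 0.
Proof. by move=> z1; rewrite -cmod_eq0 z1 oner_eq0. Qed.

Lemma conj_affine (c0 c1 z : C) : cmod z = 1 -> (c0 + c1 / z)^* = c0^* + c1^* * z.
Proof. by move=> z1; rewrite rmorphD rmorphM /= fmorphV /= (conj_unit z1) invrK. Qed.

Lemma circle_avg_norm2 K (c0 c1 : C) :
  circle_avg K.+1 (fun z => (c0 + c1 / z) * (c0 + c1 / z)^*) 1 = c0 * c0^* + c1 * c1^*.
Proof.
rewrite (@circle_avg_ext _ _ _ (fun z =>
  (c0 * c0^* + c1 * c1^*) + ((c0 * c1^*) * z + (c1 * c0^*) * z^-1))).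
  rewrite !circle_avgD !circle_avg_const (circle_avgZ _ (c0 * _)).
  by rewrite (circle_avgZ _ (c1 * _)) circle_avg_id circle_avg_inv !mulr0 !addr0.
move=> z; rewrite normr1 => z1; rewrite conj_affine //.
by have /= := cmod_unit_neq0 z1 => z0; field.
Qed.

(** Orthogonal projection on the span of [1] and [z^-1]: the average of
[|h - c0 - c1 / z|^2] is nonnegative. *)
Lemma bessel K (h : C -> C) (c0 := circle_avg K.+1 h 1)
    (c1 := circle_avg K.+1 (fun z => h z * z) 1) :
  c0 * c0^* + c1 * c1^* <= circle_avg K.+1 (fun z => h z * (h z)^*) 1.
Proof.
rewrite -subr_ge0.
have <- : circle_avg K.+1 (fun z => (h z - (c0 + c1 / z)) * (h z - (c0 + c1 / z))^*) 1 =
  circle_avg K.+1 (fun z => h z * (h z)^*) 1 - (c0 * c0^* + c1 * c1^*).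
  rewrite (@circle_avg_ext _ _ _ (fun z => (h z * (h z)^* + (c0 + c1 / z) * (c0 + c1 / z)^*) -
     ((c0^* * h z + c1^* * (h z * z)) + (c0^* * h z + c1^* * (h z * z))^*))).
    rewrite circle_avgB circle_avgD circle_avg_norm2 circle_avgD circle_avg_conj.
    rewrite circle_avgD !circle_avgZ -/c0 -/c1.
    by clearbody c0 c1; rewrite rmorphD !rmorphM /= !conjCK; ring.
  clearbody c0 c1; move=> z; rewrite normr1 => z1; rewrite rmorphB /= conj_affine //.
  rewrite rmorphD !rmorphM /= !conjCK (conj_unit z1).
  by have /= := cmod_unit_neq0 z1 => z0; field; exact: z0.
rewrite -(circle_avg_const K.+1 0 1); apply: circle_avg_le => z _; exact: mul_conjC_ge0.
Qed.

(** Bessel's inequality for [h z = g z * (v1 + v2 / z)]: its coefficients are the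
two entries on the left, and its mean square is at most [S ^+ 2] times that of
[v1 + v2 / z]. *)
Lemma toeplitz_bound_avg K (g : C -> C) S (v1 v2 : C) :
  (forall z, cmod z = 1 -> cmod (g z) <= S) ->
  cmod (v1 * circle_avg K.+1 g 1 + v2 * circle_avg K.+1 (fun z => g z / z) 1) ^+ 2 +
  cmod (v1 * circle_avg K.+1 (fun z => g z * z) 1 + v2 * circle_avg K.+1 g 1) ^+ 2
  <= S ^+ 2 * (cmod v1 ^+ 2 + cmod v2 ^+ 2).
Proof.
move=> gS; pose h z := g z * (v1 + v2 / z).
have <- : circle_avg K.+1 h 1 =
    v1 * circle_avg K.+1 g 1 + v2 * circle_avg K.+1 (fun z => g z / z) 1.
  by rewrite -!circle_avgZ -circle_avgD; apply: circle_avg_ext => z _; rewrite /h; ring.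
have <- : circle_avg K.+1 (fun z => h z * z) 1 =
    v1 * circle_avg K.+1 (fun z => g z * z) 1 + v2 * circle_avg K.+1 g 1.
  rewrite -!circle_avgZ -circle_avgD; apply: circle_avg_ext => z; rewrite normr1 => z1; rewrite /h.
  by have /= := cmod_unit_neq0 z1 => z0; field.
have le1 := bessel K h; cbv zeta in le1.
have E (a b : C) : ((cmod a ^+ 2 + cmod b ^+ 2)%:C%C : C) = a * a^* + b * b^*.
  by rewrite rmorphD /= !cmod_sqr.
rewrite -lecR rmorphM /= !E.
apply: le_trans le1 _.
rewrite -(circle_avg_norm2 K v1 v2) -circle_avgZ; apply: circle_avg_le => z; rewrite normr1 => z1.
rewrite -!cmod_sqr /h -rmorphM lecR cmodM exprMn ler_wpM2r ?sqr_ge0 //.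
by rewrite lerXn2r ?nnegrE ?cmod_ge0 ?gS //; apply: le_trans (gS _ z1); exact: cmod_ge0.
Qed.

End Bessel.

(** * The Toeplitz bound for holomorphic functions on the disc *)

Lemma small_radius (R : realType) (d e : R) : 0 < d -> 0 < e ->
  exists a : R, [/\ 0 < a, a < 1, a < d & a <= e].
Proof.
move=> d0 e0; exists (Num.min (Num.min (d / 2) (1 / 2)) e); split.
- by rewrite !lt_min e0 !divr_gt0.
- by rewrite !gt_min; apply/orP; left; apply/orP; right; lra.
- by rewrite !gt_min; apply/orP; left; apply/orP; left; lra.
- by rewrite ge_min lexx orbT.
Qed.

Section Toeplitz.
Variable R : realType.
Local Notation C := (cplx R).
Variable g : C -> C.
Hypothesis dg : forall z, cmod z <= 1 -> derivable g z 1.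

(** The average over the unit circle and that over a small circle have the same
limit, so it is enough to control the small circle, uniformly in [K]. *)
Lemma circle_avg_limit m (l : C) :
  (forall e : R, 0 < e -> exists2 a : R, 0 < a < 1 & forall K,
     cmod (circle_avg K.+1 (fun z => g z / z ^+ m * z) a - l) <= e) ->
  forall e : R, 0 < e -> exists K0, forall K, (K0 <= K)%N ->
     cmod (circle_avg K (fun z => g z / z ^+ m * z) 1 - l) <= e.
Proof.
move=> H e e0; have e20 : 0 < e / 2 by rewrite divr_gt0.
have [a a01 aP] := H _ e20.
have [|K0 K0P] := circle_avg_diff (F := fun z => g z / z ^+ m) a01 _ e20.
  move=> z /andP[az z1]; apply: has_cderiv_div; first exact: dg.
  by rewrite -cmod_gt0; apply: lt_le_trans az; case/andP: a01.
exists K0.+1 => -[//|K] KK; rewrite (splitr e).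
rewrite -(subrK (circle_avg K.+1 (fun z => g z / z ^+ m * z) a) (circle_avg _ _ 1)) -addrA.
by apply: le_trans (cmodD _ _) _; apply: lerD; [exact: K0P (ltnW KK)|exact: aP].
Qed.

Lemma taylor (e : R) : 0 < e -> exists2 d : R, 0 < d & forall z : C, cmod z < d ->
  cmod (g z - g 0 - 'D_1 g 0 * z) <= e * cmod z.
Proof.
move=> e0; have d0 : derivable g 0 1 by apply: dg; rewrite cmod0.
by have [d d_gt0 dP] := derivable_has_cderiv d0 e0; exists d => // z; have := dP z; rewrite subr0.
Qed.

Let g0 := g 0.
Let g1 := 'D_1 g 0.
Let taylor_rem (z : C) := g z - g0 - g1 * z.

Lemma circle_avg_g0 (e : R) : 0 < e -> exists K0, forall K, (K0 <= K)%N ->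
  cmod (circle_avg K g 1 - g0) <= e.
Proof.
move=> e_gt0; have [|K0 K0P] := @circle_avg_limit 1 g0 _ _ e_gt0; last first.
  exists K0 => K /K0P; rewrite (@circle_avg_ext _ _ _ (g)) // => z; rewrite normr1 => z1.
  by rewrite expr1 divfK // cmod_unit_neq0.
move=> {}e {}e_gt0; have [d d0 dP] := taylor e_gt0.
have [a [a0 a1 ad _]] := small_radius d0 ltr01.
exists a; first by rewrite a0.
move=> K; rewrite (@circle_avg_ext _ _ _ (fun z => (g0 + g1 * z) + taylor_rem z)); last first.
  move=> z za; rewrite expr1 divfK /taylor_rem; first by ring.
  by rewrite -cmod_gt0 za gtr0_norm.
rewrite circle_avgD circle_avgD circle_avg_const circle_avgZ circle_avg_id.
rewrite mulr0 addr0 [g0 + _]addrC addrK.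
apply: circle_avg_bound => z; rewrite gtr0_norm // => za.
by apply: le_trans (dP _ _) _; rewrite za // ler_piMr // ltW.
Qed.

Lemma circle_avg_g1 (e : R) : 0 < e -> exists K0, forall K, (K0 <= K)%N ->
  cmod (circle_avg K (fun z => g z / z) 1 - g1) <= e.
Proof.
move=> e_gt0; have [|K0 K0P] := @circle_avg_limit 2 g1 _ _ e_gt0; last first.
  exists K0 => K /K0P; rewrite (@circle_avg_ext _ _ _ (fun z => g z / z)) // => z.
  rewrite normr1 => z1.
  by have z0 := cmod_unit_neq0 z1; field.
move=> {}e {}e_gt0; have [d d0 dP] := taylor e_gt0.
have [a [a0 a1 ad _]] := small_radius d0 ltr01.
exists a; first by rewrite a0.
move=> K; rewrite (@circle_avg_ext _ _ _ (fun z =>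
  (g1 + g0 * z^-1) + taylor_rem z / z)); last first.
  move=> z za; have z0 : z != 0 by rewrite -cmod_gt0 za gtr0_norm.
  by rewrite /taylor_rem; field.
rewrite circle_avgD circle_avgD circle_avg_const circle_avgZ circle_avg_inv.
rewrite mulr0 addr0 [g1 + _]addrC addrK.
apply: circle_avg_bound => z; rewrite gtr0_norm // => za.
by rewrite cmodM cmodV ler_pdivrMr za // -za dP ?za.
Qed.

(** The coefficient of degree [-1] vanishes because [g z * z] is small on a small
circle. *)
Lemma circle_avg_gN1 (e : R) : 0 < e -> exists K0, forall K, (K0 <= K)%N ->
  cmod (circle_avg K (fun z => g z * z) 1) <= e.
Proof.
move=> e_gt0; have [|K0 K0P] := @circle_avg_limit 0 0 _ _ e_gt0; last first.
  exists K0 => K /K0P; rewrite subr0 (@circle_avg_ext _ _ _ (fun z => g z * z)) // => z _.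
  by rewrite expr0 divr1.
move=> {}e {}e_gt0; have [d d0 dP] := taylor ltr01.
have b0 : 0 < cmod g0 + cmod g1 + 1 by rewrite ltr_pwDr // addr_ge0 ?cmod_ge0.
have [a [a0 a1 ad ae]] := small_radius d0 (divr_gt0 e_gt0 b0).
exists a; first by rewrite a0.
move=> K; rewrite subr0; apply: circle_avg_bound => z; rewrite gtr0_norm // => za.
rewrite expr0 divr1.
have -> : g z * z = (g0 + g1 * z + taylor_rem z) * z by rewrite /taylor_rem; ring.
rewrite cmodM za.
have rz : cmod (taylor_rem z) <= a by have := dP z; rewrite za mul1r; apply.
have gz : cmod (g0 + g1 * z + taylor_rem z) <= cmod g0 + cmod g1 + 1.
  apply: le_trans (cmodD _ _) _; apply: lerD; last by apply: le_trans rz _; exact: ltW.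
  apply: le_trans (cmodD _ _) _; rewrite lerD // cmodM za ler_piMr ?cmod_ge0 //; exact: ltW.
rewrite ler_pdivlMr // in ae.
apply: le_trans ae; rewrite mulrC ler_wpM2l //; exact: ltW.
Qed.

(** Absorbs the error of replacing the coefficients of [g] by finite averages. *)
Lemma le_sqr_perturb (x N : R) : 0 <= N ->
  (forall t, 0 < t -> x <= N ^+ 2 + 4 * N * t + 2 * t ^+ 2) -> x <= N ^+ 2.
Proof.
move=> N0 H; apply/ler_addgt0Pr => e e0.
have c0 : 0 < 4 * N + 2 by lra.
pose t := Num.min 1 (e / (4 * N + 2)).
have t0 : 0 < t by rewrite lt_min ltr01 divr_gt0.
have t1 : t <= 1 by rewrite ge_min lexx.
have te : t * (4 * N + 2) <= e by rewrite -ler_pdivlMr // ge_min lexx orbT.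
have := H _ t0; nra.
Qed.

(** Von Neumann's inequality for a nilpotent matrix of order two: the left-hand
side is the squared norm of the image of [(v1, v2)] under
the upper triangular Toeplitz matrix with entries [g 0] and ['D_1 g 0], and the
estimate is the limit of [toeplitz_bound_avg]. *)
Lemma toeplitz_bound S (v1 v2 : C) :
  (forall z, cmod z = 1 -> cmod (g z) <= S) ->
  cmod (v1 * g 0 + v2 * 'D_1 g 0) ^+ 2 + cmod (v2 * g 0) ^+ 2
  <= S ^+ 2 * (cmod v1 ^+ 2 + cmod v2 ^+ 2).
Proof.
move=> gS.
have S0 : 0 <= S by apply: le_trans (gS 1 (cmod1 R)); exact: cmod_ge0.
set x := _ + _ * 'D_1 g 0; set y := v2 * g 0.
pose N := S * Num.sqrt (cmod v1 ^+ 2 + cmod v2 ^+ 2).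
have N2 : N ^+ 2 = S ^+ 2 * (cmod v1 ^+ 2 + cmod v2 ^+ 2).
  by rewrite exprMn sqr_sqrtr // addr_ge0 ?sqr_ge0.
have N0 : 0 <= N by rewrite mulr_ge0 ?sqrtr_ge0.
rewrite -N2; apply: le_sqr_perturb => // t t0.
pose w := cmod v1 + cmod v2 + 1.
have v10 := cmod_ge0 v1; have v20 := cmod_ge0 v2.
have w0 : 0 < w by rewrite /w; lra.
have e0 : 0 < t / w by rewrite divr_gt0.
have [K0 K0P] := circle_avg_g0 e0; have [K1 K1P] := circle_avg_g1 e0.
have [K2 K2P] := circle_avg_gN1 e0.
(* The successor makes the level positive: the roots of unity sum to zero
   only then. *)
pose K := (maxn K0 (maxn K1 K2)).+1.
have /K0P A0 : (K0 <= K)%N by rewrite ltnW // ltnS leq_maxl.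
have /K1P A1 : (K1 <= K)%N by rewrite ltnW // ltnS !leq_max leqnn orbT.
have /K2P A2 : (K2 <= K)%N by rewrite ltnW // ltnS !leq_max leqnn !orbT.
have := toeplitz_bound_avg K.-1 v1 v2 gS; rewrite [K.-1.+1]/= -/K -N2.
set c0 := v1 * _ + _; set c1 := v1 * _ + _ => cN.
have wt : (cmod v1 + cmod v2) * (t / w) <= t.
  by rewrite mulrCA ler_piMr ?(ltW t0) // ler_pdivrMr // mul1r /w; lra.
have xc : cmod (x - c0) <= t.
  apply: le_trans wt; rewrite mulrDl.
  have -> : x - c0 =
      v1 * - (circle_avg K g 1 - g0) + v2 * - (circle_avg K (fun z => g z / z) 1 - g1).
    by rewrite /x /c0 /g0 /g1; ring.
  by apply: le_trans (cmodD _ _) _; rewrite !cmodM !cmodN lerD // ler_wpM2l.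
have yc : cmod (y - c1) <= t.
  apply: le_trans wt; rewrite mulrDl.
  have -> : y - c1 = v1 * - circle_avg K (fun z => g z * z) 1 + v2 * - (circle_avg K g 1 - g0).
    by rewrite /y /c1 /g0; ring.
  by apply: le_trans (cmodD _ _) _; rewrite !cmodM !cmodN lerD // ler_wpM2l.
have x1 : cmod x <= cmod c0 + t.
  by rewrite -[x](subrK c0); apply: le_trans (cmodD _ _) _; rewrite addrC lerD.
have y1 : cmod y <= cmod c1 + t.
  by rewrite -[y](subrK c1); apply: le_trans (cmodD _ _) _; rewrite addrC lerD.
have x0 := cmod_ge0 x; have y0 := cmod_ge0 y; have c00 := cmod_ge0 c0; have c10 := cmod_ge0 c1.
have c0N : cmod c0 <= N.
  by rewrite -ler_sqr ?nnegrE //; have := sqr_ge0 (cmod c1); lra.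
have c1N : cmod c1 <= N.
  by rewrite -ler_sqr ?nnegrE //; have := sqr_ge0 (cmod c0); lra.
have : cmod x ^+ 2 <= (cmod c0 + t) ^+ 2 by rewrite lerXn2r ?nnegrE // addr_ge0 // ltW.
have : cmod y ^+ 2 <= (cmod c1 + t) ^+ 2 by rewrite lerXn2r ?nnegrE // addr_ge0 // ltW.
have : t * (cmod c0 + cmod c1) <= t * (N + N) by rewrite ler_wpM2l ?lerD // ltW.
nra.
Qed.

End Toeplitz.

(** * The functional calculus of multiples of a nilpotent matrix *)

Section ShiftCalculus.
Variables (R : realType) (n : nat).
Local Notation C := (cplx R).
Implicit Types (f : 'rV[C]_n -> C) (v : 'rV[C]_n).

(** Along the line through [v], the difference quotients in one variable are those
of the directional derivative. *)
Lemma derivable_line f v (z : C) : differentiable f (z *: v) ->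
  derivable (fun t : C => f (t *: v)) z 1.
Proof.
move=> df; have : derivable f (z *: v) v by exact: diff_derivable.
rewrite /derivable.
suff -> : (fun h : C => h^-1 *: (((fun t : C => f (t *: v)) \o shift z) (h *: 1) - f (z *: v))) =
  (fun h : C => h^-1 *: ((f \o shift (z *: v)) (h *: v) - f (z *: v))) by [].
by apply/funext => h /=; rewrite scalerDl [h *: 1]mulr1.
Qed.

Lemma derive_line f v : 'D_1 (fun t : C => f (t *: v)) 0 = 'D_v f 0.
Proof.
rewrite /derive.
suff -> : (fun h : C => h^-1 *: (((fun t : C => f (t *: v)) \o shift 0) (h *: 1) - f (0 *: v))) =
  (fun h : C => h^-1 *: ((f \o shift 0) (h *: v) - f 0)) by [].
by apply/funext => h /=; rewrite scale0r !addr0 [h *: 1]mulr1.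
Qed.

Lemma toeplitz_line f v S (v1 v2 : C) :
  (forall z, cmod z <= 1 -> differentiable f (z *: v)) ->
  (forall z, cmod z <= 1 -> cmod (f (z *: v)) <= S) ->
  cmod (v1 * f 0 + v2 * 'D_v f 0) ^+ 2 + cmod (v2 * f 0) ^+ 2
  <= S ^+ 2 * (cmod v1 ^+ 2 + cmod v2 ^+ 2).
Proof.
move=> df fS.
have := @toeplitz_bound R (fun t : C => f (t *: v)) _ S v1 v2.
rewrite derive_line scale0r; apply.
  by move=> z z1; apply: derivable_line; exact: df.
by move=> z z1; apply: fS; rewrite z1.
Qed.

(** The Toeplitz bound for the vector [(0, 1)]. *)
Lemma cauchy_estimate f v S :
  (forall z, cmod z <= 1 -> differentiable f (z *: v)) ->
  (forall z, cmod z <= 1 -> cmod (f (z *: v)) <= S) ->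
  cmod ('D_v f 0) <= S.
Proof.
move=> df fS; have := toeplitz_line 0 1 df fS.
have S0 : 0 <= S by apply: le_trans (fS 0 _); rewrite ?cmod_ge0 ?cmod0.
rewrite mul0r add0r mul1r cmod0 cmod1 expr0n expr1n add0r mulr1 => H.
rewrite -ler_sqr ?nnegrE ?cmod_ge0 //; apply: le_trans H.
by rewrite lerDl sqr_ge0.
Qed.

(** The value at [v N] of the first-order expansion of [f] at [0], as [N ^+ 2 = 0]. *)
Definition shift_calculus v f : 'M[C]_2 := (f 0)%:M + 'D_v f 0 *: delta_mx 0 1.

Lemma delta01_sqr : (delta_mx 0 1 : 'M[C]_2) *m (delta_mx 0 1 : 'M[C]_2) = 0.
Proof. by rewrite mul_delta_mx_0. Qed.

Lemma shift_mulmx (a b c d : C) (N := delta_mx 0 1 : 'M[C]_2) :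
  (a%:M + b *: N) *m (c%:M + d *: N) = (a * c)%:M + (a * d + c * b) *: N.
Proof.
have NN : N *m N = 0 by exact: delta01_sqr.
rewrite mulmxDl mul_scalar_mx scalerDr scale_scalar_mx scalerA.
rewrite mulmxDr mul_mx_scalar scalerA -scalemxAl -scalemxAr NN !scaler0 addr0.
by rewrite -addrA scalerDl.
Qed.

Lemma derive_coord v (i : 'I_n) : 'D_v (fun z : 'rV[C]_n => z 0 i) 0 = v 0 i.
Proof.
apply/cvg_lim => //; apply: cvg_near_cst; near=> h.
rewrite /= !mxE addr0 subr0 /GRing.scale /= mulKf //.
by near: h; exact: nbhs_dnbhs_neq.
Unshelve. all: by end_near. Qed.

Lemma shift_mulE (a b : C) (u : 'cV[C]_2) :
  ((a%:M + b *: (delta_mx 0 1 : 'M[C]_2)) *m u) 0 0 = u 0 0 * a + u 1 0 * b /\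
  ((a%:M + b *: (delta_mx 0 1 : 'M[C]_2)) *m u) 1 0 = u 1 0 * a.
Proof.
rewrite mulmxDl mul_scalar_mx -scalemxAl !mxE !big_ord_recl !big_ord0 !mxE /=.
have -> : lift ord0 ord0 = 1 :> 'I_2 by apply/val_inj.
by split; ring.
Qed.

(** A simultaneous eigenvector of nilpotent matrices has eigenvalues zero. *)
Lemma spectrum_shift (lam : 'I_n -> C) :
  joint_spectrum (fun i => lam i *: (delta_mx 0 1 : 'M[C]_2)) = [set 0].
Proof.
have mulE i (u : 'cV[C]_2) : ((lam i *: (delta_mx 0 1 : 'M[C]_2)) *m u) 0 0 = u 1 0 * lam i /\
    ((lam i *: (delta_mx 0 1 : 'M[C]_2)) *m u) 1 0 = 0.
  have := shift_mulE 0 (lam i) u.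
  by rewrite -scalemx1 scale0r add0r !mulr0 add0r.
apply/seteqP; split=> [l [u u0 lu]|_ ->].
  apply/rowP => i; rewrite [RHS]mxE.
  have [//|li] := eqVneq (l 0 i) 0.
  have [e0 e1] := mulE i u; rewrite lu !mxE in e0 e1.
  have u1 : u 1 0 = 0 by apply: (mulfI li); rewrite e1 mulr0.
  have u00 : u 0 0 = 0 by apply: (mulfI li); rewrite e0 u1 mul0r mulr0.
  case/negP: u0; apply/eqP/colP => -[[|[|//]] k]; rewrite [RHS]mxE.
    by rewrite -u00; congr (u _ _); exact/val_inj.
  by rewrite -u1; congr (u _ _); exact/val_inj.
exists (delta_mx 0 0).
  by apply/eqP => /matrixP/(_ 0 0)/eqP; rewrite !mxE oner_eq0.
by move=> i; rewrite mxE scale0r -scalemxAl mul_delta_mx_0 ?scaler0.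
Qed.

(** The algebraic rules are those of the derivative at [0]; continuity follows from
Cauchy's estimate for [f_ k - f] along a multiple of [v] that keeps the disc
inside [U]. *)
Lemma shift_calculus_holo v : let T i := v 0 i *: (delta_mx 0 1 : 'M[C]_2) in
  holomorphic_calculus T (shift_calculus v).
Proof.
move=> T; have sp : joint_spectrum T = [set 0] by exact: spectrum_shift.
have dif f : holomorphic_near (joint_spectrum T) f -> differentiable f 0.
  by rewrite sp => -[U [_ U0 dU]]; apply: dU; exact: U0.
split.
- by rewrite /shift_calculus derive_cst scale0r addr0.
- by move=> i; rewrite /shift_calculus derive_coord mxE raddf0 add0r.
- move=> f g /dif df /dif dg; rewrite /shift_calculus.
  have -> : 'D_v (fun z => f z + g z) 0 = 'D_v f 0 + 'D_v g 0.
    by rewrite -deriveD //; exact: diff_derivable.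
  by rewrite scalerDl raddfD /= addrACA.
- move=> c f /dif df; rewrite /shift_calculus.
  have -> : 'D_v (fun z => c * f z) 0 = c * 'D_v f 0.
    by rewrite -[RHS]deriveZ //; exact: diff_derivable.
  by rewrite scalerDr scale_scalar_mx scalerA.
- move=> f g /dif df /dif dg; rewrite /shift_calculus.
  have -> : 'D_v (fun z => f z * g z) 0 = f 0 * 'D_v g 0 + g 0 * 'D_v f 0.
    by rewrite -[RHS]deriveM //; exact: diff_derivable.
  by rewrite shift_mulmx.
- move=> f g U oU; rewrite sp => U0 _ fg; rewrite /shift_calculus.
  have U00 : U 0 by exact: U0.
  have -> : 'D_v f 0 = 'D_v g 0.
    apply: near_eq_derive.
    by apply: filterS (open_nbhs_nbhs (conj oU U00)) => z Uz; exact: fg.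
  by rewrite (fg 0 U00).
- move=> f_ f U oU; rewrite sp => U0 dF df fcvg.
  have U00 : U 0 by exact: U0.
  have unif (e : R) : 0 < e -> exists k0, forall k, (k0 <= k)%N ->
      forall z, U z -> cmod (f_ k z - f z) <= e.
    move=> e0; have eC : 0 < (e%:C%C : C) by rewrite ltcR.
    have [] := fcvg [set h | forall z, U z -> `|f z - h z| < e%:C%C].
      apply/uniform_nbhs; exists [set xy : C * C | `|xy.1 - xy.2| < e%:C%C]; split => //.
      by have := @entourage_ball _ C (PosNum eC).
    move=> k0 _ kP; exists k0 => k kk z Uz.
    have := kP k kk z Uz; rewrite normE ltcR cmodB => /ltW; exact.
  have [eta eta0 etaP] : exists2 eta : R, 0 < eta & forall z : C, cmod z <= 1 ->
      U (z *: (eta%:C%C *: v)).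
    have /nbhs_ballP[d /= d0 dU] := open_nbhs_nbhs (conj oU U00).
    have [r r0 dr] := gt0_cplx d0.
    have nv0 : 0 <= `|v| by [].
    have [s sv] : exists s : R, `|v| = s%:C%C.
      by exists (complex.Re `|v|); rewrite RRe_real // ger0_real.
    have s0 : 0 <= s by rewrite -lecR -sv.
    (* The added one covers the case [v = 0]. *)
    exists (r / (s + 1)); first by rewrite divr_gt0 // ltr_wpDl.
    move=> z z1; apply: dU; rewrite -ball_normE /= sub0r normrN !normrZ normE dr sv.
    rewrite normE cmod_real gtr0_norm ?divr_gt0 ?ltr_wpDl // -!rmorphM ltcR.
    apply: (@le_lt_trans _ _ (r / (s + 1) * s)).
      by rewrite ler_piMl // mulr_ge0 // divr_ge0 ?ltW // ltr_wpDl.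
    have s1 : 0 < s + 1 by rewrite ltr_wpDl.
    by rewrite mulrAC ltr_pdivrMr // ltr_pM2l // ltrDl.
  have bound (e : R) : 0 < e -> exists k0, forall k, (k0 <= k)%N ->
      cmod (f_ k 0 - f 0) <= e /\ cmod ('D_v (f_ k) 0 - 'D_v f 0) <= e.
    move=> e0; have m0 : 0 < Num.min e (e * eta) by rewrite lt_min e0 mulr_gt0.
    have [k0 k0P] := unif _ m0; exists k0 => k kk; split.
      by apply: le_trans (k0P k kk 0 U00) _; rewrite ge_min lexx.
    have := @cauchy_estimate (fun z => f_ k z - f z) (eta%:C%C *: v) (e * eta).
    have dk : differentiable (f_ k) 0 by exact: dF.
    have df0 : differentiable f 0 by exact: df.
    have -> : 'D_(eta%:C%C *: v) (fun z => f_ k z - f z) 0 =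
        eta%:C%C * ('D_v (f_ k) 0 - 'D_v f 0).
      have dB : differentiable (f_ k - f) 0 by exact: differentiableB.
      rewrite -deriveB; try exact: diff_derivable.
      by rewrite !deriveE // linearZ.
    rewrite cmodM cmod_real gtr0_norm // => H.
    rewrite -(ler_pM2r eta0) mulrC; apply: H.
      by move=> z /etaP Uz; apply: differentiableB; [exact: dF|exact: df].
    by move=> z /etaP Uz; apply: le_trans (k0P k kk _ Uz) _; rewrite ge_min lexx orbT.
  have sc (a_ : nat -> C) (a : C) : (forall e : R, 0 < e -> exists k0, forall k, (k0 <= k)%N ->
      cmod (a_ k - a) <= e) -> a_ k @[k --> \oo] --> a.
    move=> H; apply/cvgrPdist_le => e /gt0_cplx[r r0 ->].
    have [k0 k0P] := H r r0; exists k0 => // k /= /k0P.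
    by rewrite normE lecR cmodB.
  rewrite /shift_calculus; apply: cvgD.
    rewrite -scalemx1; under eq_fun do rewrite -scalemx1.
    apply: cvgZr_tmp; apply: sc => e /bound[k0 k0P]; exists k0 => k /k0P[]//.
  apply: cvgZr_tmp; apply: sc => e /bound[k0 k0P]; exists k0 => k /k0P[]//.
Qed.

Lemma shift_calculus_norm v f S :
  (forall z, cmod z <= 1 -> differentiable f (z *: v)) ->
  (forall z, cmod z <= 1 -> cmod (f (z *: v)) <= S) ->
  op_norm (shift_calculus v f) <= S.
Proof.
move=> df fS.
have S0 : 0 <= S by apply: le_trans (fS 0 _); rewrite ?cmod_ge0 ?cmod0.
apply: ge_sup.
  exists (l2norm (shift_calculus v f *m 0)), 0 => //.
  rewrite /= /l2norm big1 ?sqrtr0 // => i _; by rewrite mxE cmod0 expr0n.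
move=> _ [u /= u1 <-].
have l2E (w : 'cV[C]_2) : l2norm w = Num.sqrt (cmod (w 0 0) ^+ 2 + cmod (w 1 0) ^+ 2).
  rewrite /l2norm !big_ord_recl big_ord0 addr0.
  by have -> : lift ord0 ord0 = 1 :> 'I_2 by apply/val_inj.
have [e0 e1] := shift_mulE (f 0) ('D_v f 0) u.
move: u1; rewrite !l2E /shift_calculus e0 e1 => u1.
rewrite -ler_sqr ?nnegrE ?sqrtr_ge0 // sqr_sqrtr ?addr_ge0 ?sqr_ge0 //.
apply: le_trans (toeplitz_line _ _ df fS) _.
rewrite ler_piMr ?sqr_ge0 // -[leLHS]sqr_sqrtr ?addr_ge0 ?sqr_ge0 //.
by rewrite expr_le1 ?sqrtr_ge0.
Qed.

End ShiftCalculus.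

(** * Spectral sets containing a disc *)

Section SpectralShift.
Variables (R : realType) (n : nat).
Local Notation C := (cplx R).

(** Restricting a function to the disc [z *: v] reduces the bound to one variable. *)
Lemma spectral_set_shift (Om : set 'rV[C]_n) (v : 'rV[C]_n) :
  (forall z, cmod z <= 1 -> Om (z *: v)) ->
  spectral_set Om (fun i => v 0 i *: (delta_mx 0 1 : 'M[C]_2)).
Proof.
move=> vOm; have sp := spectrum_shift (fun i => v 0 i).
have Om0 : Om 0 by rewrite -(scale0r v); apply: vOm; rewrite cmod0.
split.
- by move=> i j; rewrite -!scalemxAl -!scalemxAr !mul_delta_mx_0 // !scaler0.
- by rewrite sp => _ ->.
exists (shift_calculus v); first exact: shift_calculus_holo.
move=> f [U [oU OmU dU [B fB]]]; apply: shift_calculus_norm => z z1.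
  by apply: dU; apply: OmU; exact: vOm.
apply: ub_le_sup; last by exists (z *: v) => //; exact: vOm.
by exists B => _ [w /OmU Uw <-]; exact: fB.
Qed.

Lemma elem_sym_bound (z : 'rV[C]_n) (t : R) i :
  (forall k, cmod (z 0 k) <= t) -> cmod (elem_sym i z) <= 'C(n, i)%:R * t ^+ i.
Proof.
move=> zt; apply: le_trans (cmod_sum _ _ _) _.
apply: (@le_trans _ _ (\sum_(A : {set 'I_n} | #|A| == i) t ^+ i)).
  apply: ler_sum => A /eqP <-; rewrite cmod_prod -prodr_const.
  by apply: ler_prod => k _; rewrite cmod_ge0 zt.
have <- : #|[set A : {set 'I_n} | #|A| == i]%SET| = 'C(n, i) by rewrite card_draws card_ord.
by rewrite sumr_const mulr_natl cardsE.
Qed.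

Lemma polydisc_in_Gamma (r : R) (z : C) (w : 'rV[C]_n) : 0 < r ->
  [set (r%:C%C : C) *: z | z in closed_polydisc R n] `<=` open_sym_polydisc R n ->
  (forall k, cmod (w 0 k) <= r) -> cmod z <= 1 -> Gamma R n (z *: w).
Proof.
move=> r0 rG wr z1; have : open_sym_polydisc R n (z *: w).
  apply: rG; exists ((r^-1%:C%C * z) *: w).
    move=> k; rewrite mxE normE -[1]/((1 : R)%:C%C) lecR !cmodM cmod_real.
    rewrite gtr0_norm ?invr_gt0 // -mulrA mulrC ler_pdivrMr // mul1r.
    by apply: le_trans (wr k); rewrite ler_piMl ?cmod_ge0.
  by rewrite scalerA mulrA -rmorphM mulfV ?gt_eqF // mul1r.
by case=> y y1 <-; exists y => // k; exact: ltW.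
Qed.

End SpectralShift.

(** Symmetry of binomial coefficients and Pascal's rule. *)
Lemma bin_reflect n i : (1 <= i <= n)%N -> ('C(n.-1, i) + 'C(n.-1, n - i))%N = 'C(n, i).
Proof.
case: i n => [|i] [|n] //= /ltnSE le_in.
by rewrite binS subSS bin_sub.
Qed.

(** * Fundamental operators in dimension two *)

Section Matrix2.
Variable R : realType.
Local Notation C := (cplx R).

Lemma ord2_eq1 : lift ord0 ord0 = 1 :> 'I_2.
Proof. exact/val_inj. Qed.

Lemma mul2E m p (A : 'M[C]_(m, 2)) (B : 'M[C]_(2, p)) i j :
  (A *m B) i j = A i 0 * B 0 j + A i 1 * B 1 j.
Proof. by rewrite mxE !big_ord_recl big_ord0 addr0 ord2_eq1. Qed.

Lemma mx2P (A B : 'M[C]_2) : A 0 0 = B 0 0 -> A 0 1 = B 0 1 ->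
  A 1 0 = B 1 0 -> A 1 1 = B 1 1 -> A = B.
Proof.
have E (k : 'I_2) : k = 0 \/ k = 1.
  by case: k => -[|[|//]] k; [left|right]; exact/val_inj.
move=> e00 e01 e10 e11; apply/matrixP => i j.
by case: (E i) => ->; case: (E j) => ->.
Qed.

Lemma one_subE (G : 'M[C]_2) i j : (1%:M - G) i j = (i == j)%:R - G i j.
Proof. by rewrite mxE [X in _ + X]mxE mxE. Qed.

Definition diag2 (d : R) : 'M[C]_2 := delta_mx 0 0 + d%:C%C *: delta_mx 1 1.

Lemma diag2_sandwich d (F : 'M[C]_2) :
  [/\ (diag2 d *m F *m diag2 d) 0 0 = F 0 0,
      (diag2 d *m F *m diag2 d) 0 1 = F 0 1 * d%:C%C,
      (diag2 d *m F *m diag2 d) 1 0 = F 1 0 * d%:C%C &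
      (diag2 d *m F *m diag2 d) 1 1 = F 1 1 * d%:C%C ^+ 2].
Proof. by split; rewrite !mul2E !mxE /=; ring. Qed.

Lemma diag2_unit d : d != 0 -> diag2 d \in unitmx.
Proof.
move=> d0; suff /mulmx1_unit[] : diag2 d *m diag2 d^-1 = 1%:M by [].
have dd : (d%:C%C : C) * (d^-1)%:C%C = 1 by rewrite -rmorphM mulfV.
by apply: mx2P; rewrite mul2E !mxE /= ?(mulr0, mulr1, mul0r, addr0, add0r).
Qed.

Definition shift_mx (c : C) : 'M[C]_2 := c *: delta_mx 0 1.

Lemma shift_mx_gram (c e : C) : [/\ ((shift_mx c) ^t* *m shift_mx e) 0 0 = 0,
 ((shift_mx c) ^t* *m shift_mx e) 0 1 = 0, ((shift_mx c) ^t* *m shift_mx e) 1 0 = 0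
 & ((shift_mx c) ^t* *m shift_mx e) 1 1 = c^* * e].
Proof.
by split; rewrite !mul2E !mxE /= ?(mulr0, mulr1, mul0r, addr0, add0r, oppr0, rmorph0).
Qed.

Lemma defect_diag2 (c : C) (d : R) : 0 <= d -> d ^+ 2 = 1 - cmod c ^+ 2 ->
  is_defect (shift_mx c) (diag2 d).
Proof.
move=> d0 d2; have dd : (d%:C%C : C) * d%:C%C = 1 - c^* * c.
  by rewrite -expr2 -rmorphXn /= d2 rmorphB /= cmod_sqr mulrC.
split; last first.
  have [e00 e01 e10 e11] := shift_mx_gram c c.
  by apply: mx2P; rewrite mul2E one_subE ?e00 ?e01 ?e10 ?e11 !mxE /=
    ?(mulr0, mulr1, mul0r, addr0, add0r, subr0, oppr0).
have dr : (d%:C%C : C)^* = d%:C%C by apply/CrealP; rewrite ger0_real // ler0c.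
split.
  by apply: mx2P; rewrite !mxE /= ?(mulr0, mulr1, mul0r, addr0, add0r, oppr0, rmorph0, rmorph1).
move=> v; rewrite !mul2E !mxE /= ?(mulr0, mulr1, mul0r, addr0, add0r).
by rewrite -mulrA [_ * v 1 0]mulrC mulrA -!normCKC addr_ge0 ?mulr_ge0 ?exprn_ge0 // ler0c.
Qed.

(** The off-diagonal entry [b] of a positive root satisfies [b (D_00 + D_11) = 0];
if [b] is nonzero the diagonal vanishes, and the two diagonal entries of the
square coincide, which forces [c = 0]. *)
Lemma defect_uniq (c : C) (d : R) D : c != 0 -> 0 <= d -> d ^+ 2 = 1 - cmod c ^+ 2 ->
  is_defect (shift_mx c) D -> D = diag2 d.
Proof.
move=> c0 d0 d2 [[Dsa Dpos] Dsq].
have dd : (d%:C%C : C) ^+ 2 = 1 - c^* * c.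
  by rewrite -rmorphXn /= d2 rmorphB /= cmod_sqr mulrC.
have [g00 g01 g10 g11] := shift_mx_gram c c.
have D10 : D 1 0 = (D 0 1)^* by rewrite {1}Dsa !mxE.
have a0 : 0 <= D 0 0.
  have := Dpos (delta_mx 0 0); rewrite !mul2E !mxE /=.
  by rewrite ?(mulr0, mulr1, mul0r, mul1r, addr0, add0r, oppr0, rmorph0, rmorph1).
have e0 : 0 <= D 1 1.
  have := Dpos (delta_mx 1 0); rewrite !mul2E !mxE /=.
  by rewrite ?(mulr0, mulr1, mul0r, mul1r, addr0, add0r, oppr0, rmorph0, rmorph1).
have E i j : D i 0 * D 0 j + D i 1 * D 1 j = (1%:M - (shift_mx c)^t* *m shift_mx c) i j.
  by rewrite -mul2E Dsq.
have E00 := E 0 0; have E01 := E 0 1; have E11 := E 1 1.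
rewrite one_subE g00 /= subr0 in E00.
rewrite one_subE g01 /= subr0 in E01.
rewrite one_subE g11 /= -dd in E11.
have b0 : D 0 1 = 0.
  have : D 0 1 * (D 0 0 + D 1 1) = 0 by rewrite mulrDr mulrC E01.
  move/eqP; rewrite mulf_eq0 => /orP[/eqP //|].
  rewrite paddr_eq0 // => /andP[/eqP z0 /eqP z1].
  move: E00 E11; rewrite z0 z1 !mul0r add0r addr0 D10 mulrC => -> /eqP.
  by rewrite dd eq_sym subr_eq addrC -subr_eq subrr eq_sym mulf_eq0 conjC_eq0 (negbTE c0).
have a1 : D 0 0 = 1.
  apply/eqP; rewrite -(@eqrXn2 _ 2) ?ler01 // expr1n expr2.
  by move: E00; rewrite b0 mul0r addr0 => ->.
have e1 : D 1 1 = d%:C%C.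
  apply/eqP; rewrite -(@eqrXn2 _ 2) ?ler0c // dd.
  by rewrite expr2; move: E11; rewrite D10 b0 mulr0 add0r => ->; rewrite dd.
by apply: mx2P; rewrite ?D10 ?b0 ?a1 ?e1 !mxE /= ?(mulr0, mulr1, addr0, add0r, oppr0, rmorph0).
Qed.

(** The shape of the solutions of the equations that define the fundamental
operators; the sign is that of [- (T_(n-i))^* T_n]. *)
Definition fundamental_mx (a b : C) : 'M[C]_2 := a *: delta_mx 0 1 - b *: delta_mx 1 1.

Lemma fundamental_mx_sandwich (d : R) (a b : C) (F : 'M[C]_2) : d != 0 ->
  diag2 d *m F *m diag2 d = fundamental_mx (a * d%:C%C) (b * d%:C%C ^+ 2) <->
  F = fundamental_mx a b.
Proof.
move=> d0; have dC : (d%:C%C : C) != 0 by rewrite -cmod_eq0 cmod_real normr_eq0.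
have [s00 s01 s10 s11] := diag2_sandwich d F.
split=> [e|->].
  move: s00 s01 s10 s11.
  rewrite e !mxE /= !(mulr0, mulr1, addr0, add0r, subr0, sub0r, oppr0).
  move=> s00 s01 s10 s11.
  apply: mx2P; rewrite !mxE /= !(mulr0, mulr1, addr0, add0r, subr0, sub0r, oppr0).
  - by rewrite -s00.
  - by apply: (mulIf dC); rewrite -s01.
  - by apply: (mulIf dC); rewrite -s10 mul0r.
  - by apply: (mulIf (expf_neq0 2 dC)); rewrite -s11 mulNr.
have [t00 t01 t10 t11] := diag2_sandwich d (fundamental_mx a b).
by apply: mx2P; rewrite ?t00 ?t01 ?t10 ?t11 !mxE /=; ring.
Qed.

Lemma shift_mx_fundamental (a b c : C) :
  shift_mx a - (shift_mx b)^t* *m shift_mx c = fundamental_mx a (b^* * c).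
Proof.
have [e00 e01 e10 e11] := shift_mx_gram b c.
have sE (A B : 'M[C]_2) i j : (A - B) i j = A i j - B i j by rewrite !mxE.
by apply: mx2P; rewrite sE ?e00 ?e01 ?e10 ?e11 !mxE /=; ring.
Qed.

(** Compare the entries in position [(0, 1)]. *)
Lemma fundamental_mx_comm (a b a' b' : C) :
  fundamental_mx a b *m fundamental_mx a' b' =
  fundamental_mx a' b' *m fundamental_mx a b -> a * b' = a' * b.
Proof.
move=> /matrixP/(_ 0 1); rewrite !mul2E !mxE /=.
by rewrite !(mulr0, mulr1, mul0r, addr0, add0r, subr0, sub0r, oppr0, mulrN) => /oppr_inj.
Qed.

Lemma corner_adj (F G : 'M[C]_2) : F 0 0 = 0 -> F 1 0 = 0 -> G 0 0 = 0 -> G 1 0 = 0 ->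
  (F *m G^t*) 0 0 = F 0 1 * (G 0 1)^* /\ (G^t* *m F) 0 0 = 0.
Proof.
move=> F00 F10 G00 G10; rewrite !mul2E F00 F10 !mulr0 addr0 mul0r add0r.
by rewrite mxE mxE.
Qed.

Lemma fundamental_mx_entries a b :
  [/\ fundamental_mx a b 0 0 = 0, fundamental_mx a b 0 1 = a
    & fundamental_mx a b 1 0 = 0].
Proof. by split; rewrite !mxE /= ?mulr0 ?mulr1 subr0. Qed.

Lemma corner_adjB (F G F' G' : 'M[C]_2) :
  F 0 0 = 0 -> F 1 0 = 0 -> G 0 0 = 0 -> G 1 0 = 0 ->
  F' 0 0 = 0 -> F' 1 0 = 0 -> G' 0 0 = 0 -> G' 1 0 = 0 ->
  F *m G^t* - F' *m G'^t* = G^t* *m F - G'^t* *m F' ->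
  F 0 1 * (G 0 1)^* = F' 0 1 * (G' 0 1)^*.
Proof.
move=> F0 F1 G0 G1 F'0 F'1 G'0 G'1.
have [<- r1] := corner_adj F0 F1 G0 G1; have [<- r2] := corner_adj F'0 F'1 G'0 G'1.
move: (F *m _) (F' *m _) (_ *m F) (_ *m F') r1 r2 => A B A' B' r1 r2.
move=> /matrixP/(_ 0 0); rewrite !mxE r1 r2 subrr => /eqP.
by rewrite subr_eq0 => /eqP.
Qed.

(** Compare the upper left entries: on the right-hand side they vanish because the
first columns do. *)
Lemma fundamental_mx_adj (a b a' b' x y x' y' : C) :
  fundamental_mx a b *m (fundamental_mx x y)^t* -
  fundamental_mx a' b' *m (fundamental_mx x' y')^t* =
  (fundamental_mx x y)^t* *m fundamental_mx a b -
  (fundamental_mx x' y')^t* *m fundamental_mx a' b' -> a * x^* = a' * x'^*.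
Proof.
have [a0 a1 a2] := fundamental_mx_entries a b; have [b0 b1 b2] := fundamental_mx_entries a' b'.
have [x0 x1 x2] := fundamental_mx_entries x y; have [y0 y1 y2] := fundamental_mx_entries x' y'.
move=> e; have := corner_adjB a0 a2 x0 x2 b0 b2 y0 y2 e.
by rewrite a1 b1 x1 y1.
Qed.

End Matrix2.

(** * The theorem *)

Unset Implicit Arguments.
Set Strict Implicit.

Theorem theorem2p4 (R : realType) (n : nat) (hn : (2 <= n)%N)
    (r : R) (hr : 0 < r < 1)
    (hrG : [set (r%:C%C : cplx R) *: z | z in closed_polydisc R n]
             `<=` open_sym_polydisc R n)
    (delta : 'rV[cplx R]_n) :
  let k i := ('C(n.-1, i) + 'C(n.-1, n - i))%N in
  let M := (\max_(1 <= i < n.+1) k i)%N in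
  let lam i := elem_sym i delta in
  let T i : 'M[cplx R]_2 := lam i *: delta_mx 0 1 in
  (forall i, 0 < cmod (delta 0 i) < r / M%:R) ->
  (forall i, (1 <= i <= n)%N -> lam i <> 0) ->
  (forall i j, (1 <= i < n)%N -> (1 <= j < n)%N -> i <> j ->
     lam i * (lam (n - j)%N)^* <> lam j * (lam (n - i)%N)^*) ->
  Gamma_contraction n T /\
  exists F : nat -> 'M[cplx R]_2,
    [/\ fundamental_operators n T F,
        forall F', fundamental_operators n T F' ->
          forall i, (1 <= i < n)%N -> F' i = F i
      & forall i j, (1 <= i < n)%N -> (1 <= j < n)%N -> i <> j ->
          F i *m F j <> F j *m F i /\
          F i *m (F (n - j)%N) ^t* - F j *m (F (n - i)%N) ^t* <>
            (F (n - j)%N) ^t* *m F i - (F (n - i)%N) ^t* *m F j].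
Proof.
move=> k M lam T hdelta lam0 lam_ne.
have [r0 r1] := andP hr.
have kM i : (1 <= i <= n)%N -> ('C(n, i) <= M)%N.
  move=> i1n; rewrite -bin_reflect //; apply: (@leq_bigmax_seq _ _ xpredT k) => //.
  by rewrite mem_index_iota ltnS.
have M1 : (1 <= M)%N by apply: leq_trans (kM 1%N _); rewrite ?bin1 (ltnW hn).
have M0 : 0 < M%:R :> R by rewrite ltr0n.
have t0 : 0 <= r / M%:R by rewrite divr_ge0 ?ler0n // ltW.
have t1 : r / M%:R <= 1.
  by rewrite ler_pdivrMr // mul1r (le_trans (ltW r1)) // ler1n.
have lam_r i : (1 <= i <= n)%N -> cmod (lam i) <= r.
  move=> i1n; apply: le_trans (elem_sym_bound (t := r / M%:R) _ _) _.
    by move=> j; apply: ltW; case/andP: (hdelta j).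
  apply: (@le_trans _ _ (M%:R * (r / M%:R))); last by rewrite mulrC divfK // gt_eqF.
  apply: ler_pM; rewrite ?ler0n ?exprn_ge0 ?ler_nat ?kM //.
  by rewrite -[leRHS]expr1 ler_wiXn2l //; case/andP: i1n.
have n1n : (1 <= n <= n)%N by rewrite leqnn (ltnW hn).
split.
  rewrite /Gamma_contraction.
  have -> : (fun i : 'I_n => T i.+1) =
      fun i : 'I_n => symmetrization delta 0 i *: (delta_mx 0 1 : 'M[cplx R]_2).
    by apply/funext => i; rewrite mxE.
  apply: spectral_set_shift => z z1; apply: (polydisc_in_Gamma r0 hrG) => // i.
  by rewrite mxE; apply: lam_r; rewrite /= ltn_ord.
have cn0 : lam n != 0 by apply/eqP; exact: lam0.
have cn1 : cmod (lam n) < 1 by apply: le_lt_trans r1; exact: lam_r.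
have d2_gt0 : 0 < 1 - cmod (lam n) ^+ 2.
  by rewrite subr_gt0 expr_lt1 ?cmod_ge0.
pose d := Num.sqrt (1 - cmod (lam n) ^+ 2).
have d_gt0 : 0 < d by rewrite sqrtr_gt0.
have d_neq0 : d != 0 by rewrite gt_eqF.
have d2 : d ^+ 2 = 1 - cmod (lam n) ^+ 2 by rewrite sqr_sqrtr // ltW.
have dC : (d%:C%C : cplx R) != 0 by rewrite -cmod_eq0 cmod_real normr_eq0.
pose F i := fundamental_mx (lam i / d%:C%C) ((lam (n - i)%N)^* * lam n / d%:C%C ^+ 2).
have FE (G : 'M[cplx R]_2) i :
    T i - (T (n - i)%N)^t* *m T n = diag2 d *m G *m diag2 d <-> G = F i.
  have [fs sf] := fundamental_mx_sandwich (lam i / d%:C%C)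
    ((lam (n - i)%N)^* * lam n / d%:C%C ^+ 2) G d_neq0.
  move: fs sf; rewrite !divfK ?expf_neq0 // => fs sf.
  by rewrite -/(shift_mx _) shift_mx_fundamental; split=> [/esym|/sf].
exists F; split.
- exists (diag2 d); first exact: defect_diag2 (ltW d_gt0) d2.
  move=> i _; split; last exact/FE.
  have u := diag2_unit d_neq0.
  by split; apply: submx_full; rewrite row_full_unit ?unitmx_tr.
- move=> F' [D Ddef DF] i i1n; apply/FE.
  by rewrite -(defect_uniq cn0 (ltW d_gt0) d2 Ddef); case: (DF i i1n).
move=> i j i1n j1n ij; split.
  move=> /fundamental_mx_comm e; apply: (lam_ne i j) => //; move: e.
  move/(congr1 (fun x => x * d%:C%C ^+ 3 / lam n)).
  have -> : lam i / d%:C%C * ((lam (n - j)%N)^* * lam n / d%:C%C ^+ 2) * d%:C%C ^+ 3 / lam n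
    = lam i * (lam (n - j)%N)^* by field; rewrite cn0.
  by move=> ->; field; rewrite cn0.
(* Both corner entries carry the real factor [d ^- 2]. *)
have dr : (d%:C%C : cplx R)^* = d%:C%C.
  by apply/CrealP; rewrite ger0_real // ler0c ltW.
have conjE (x y : cplx R) : x / d%:C%C * (y / d%:C%C)^* = x * y^* / d%:C%C ^+ 2.
  by rewrite rmorphM /= fmorphV /= dr; field.
move=> /fundamental_mx_adj; rewrite !conjE => e; apply: (lam_ne i j) => //.
by apply: mulIf e; rewrite invr_eq0 expf_neq0.
Qed.
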